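(* Balanced Cluster Editing admits an algorithm running in time $4^{k+o(k)}\cdot n^{\mathcal{O}(1)}$, where $n$ is the number of vertices of the input graph.
   Context: All graphs are finite and simple. A cluster graph is a graph in which every connected component is a clique. For a non-negative integer $\eta$, a graph is $\eta$-balanced if for any two connected components $H,H'$ we have $\big||V(H)|-|V(H')|\big|\le\eta$. Balanced Cluster Editing: given a graph $G$ and non-negative integers $k,\eta$, decide whether there is $F\subseteq\binom{V(G)}{2}$ with $|F|\le k$ such that the graph $(V(G),E(G)\triangle F)$ is an $\eta$-balanced cluster graph. *)

(* Defs.v *)
From HB Require Import structures.
From mathcomp Require Import all_boot all_order all_algebra.

Set Implicit Arguments.
Unset Strict Implicit.
Unset Printing Implicit Defensive.

(** A simple graph on [V] is given by its set of edges, a subset of [pairs V]. *)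

Section Graphs.
Variable V : finType.
Implicit Types (E F : {set {set V}}) (k eta : nat).

Definition pairs : {set {set V}} := [set A : {set V} | #|A| == 2].

Definition adj E : rel V := [rel x y | [set x; y] \in E].

Definition component E (x : V) : {set V} := [set y | connect (adj E) x y].

Definition components E : {set {set V}} := [set component E x | x : V].

Definition is_clique E (H : {set V}) : Prop :=
  forall x y : V, x \in H -> y \in H -> x != y -> adj E x y.

Definition cluster_graph E : Prop :=
  forall H, H \in components E -> is_clique E H.

Definition balanced eta E : Prop :=
  forall H H', H \in components E -> H' \in components E ->
    `| (#|H|%:Z - #|H'|%:Z)%R |%N <= eta.

Definition symdiff E F : {set {set V}} := (E :\: F) :|: (F :\: E).

Definition balanced_cluster_editing E k eta : Prop :=
  exists F : {set {set V}},
    [/\ F \subset pairs, #|F| <= k,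
        cluster_graph (symdiff E F) & balanced eta (symdiff E F)].

End Graphs.

Arguments pairs V : clear implicits.

(** Algorithms are random access machine programs in structured form.

    The memory consists of cells [X_0, X_1, ...] holding natural numbers, and
    every operation and every test has cost 1.  No operation increases the
    largest number in memory by more than 1 (or beyond a constant of the
    program), so after [t] steps the cells hold numbers of
    [O(log (t + largest input number))] bits: unit cost does not hide
    arithmetic on long numbers. *)

Definition memory := nat -> nat.

Definition upd (m : memory) (a v : nat) : memory :=
  fun x => if x == a then v else m x.

Inductive prog :=
| Skip
| Const of nat & nat
| Copy of nat & nat
| Succ of nat & nat
| Sub of nat & nat & nat
| Read of nat & nat
| Write of nat & nat
| Seq of prog & prog
| If of nat & prog & prog
| While of nat & prog.

(** [exec p m t m']: started on memory [m], program [p] halts after exactly [t]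
    steps with memory [m']. *)
Inductive exec : prog -> memory -> nat -> memory -> Prop :=
| exec_Skip m : exec Skip m 1 m
| exec_Const m a c : exec (Const a c) m 1 (upd m a c)
| exec_Copy m a b : exec (Copy a b) m 1 (upd m a (m b))
| exec_Succ m a b : exec (Succ a b) m 1 (upd m a (m b).+1)
| exec_Sub m a b c : exec (Sub a b c) m 1 (upd m a (m b - m c))
| exec_Read m a b : exec (Read a b) m 1 (upd m a (m (m b)))
| exec_Write m a b : exec (Write a b) m 1 (upd m (m a) (m b))
| exec_Seq p q m t m' t' m'' :
    exec p m t m' -> exec q m' t' m'' -> exec (Seq p q) m (t + t') m''
| exec_If_true a p q m t m' :
    m a != 0 -> exec p m t m' -> exec (If a p q) m t.+1 m'
| exec_If_false a p q m t m' :
    m a = 0 -> exec q m t m' -> exec (If a p q) m t.+1 m'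
| exec_While_true a p m t m' t' m'' :
    m a != 0 -> exec p m t m' -> exec (While a p) m' t' m'' ->
    exec (While a p) m (t + t').+1 m''
| exec_While_false a p m :
    m a = 0 -> exec (While a p) m 1 m.

(** The instance [(G, k, eta)] with [V(G) = {0, ..., n-1}] is written in memory
    as [n], [k], [eta], followed by the [n * n] adjacency matrix of [G] in
    row-major order; all further cells are 0. *)
Definition encode (n : nat) (E : {set {set 'I_n}}) (k eta : nat) : memory :=
  fun a =>
    if a == 0 then n
    else if a == 1 then k
    else if a == 2 then eta
    else [exists i : 'I_n, exists j : 'I_n, (a == 3 + (i * n + j)) && adj E i j].

Definition accepts (m : memory) : Prop := m 0 != 0.

(* Main.v *)
(** A run of the algorithm is driven by a string of [k] digits in [{0,1,2,3}];
    the machine tries all [4 ^ k] strings, each in polynomial time.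

    While the graph contains an induced path [x - y - z], every solution edits
    one of the pairs [xy], [yz], [xz], and one digit tells which.  On a cluster
    graph only the sizes of the cliques matter, and the distance between two
    cluster graphs is the length of a shortest path of splits and merges, where
    splitting a clique of size [p + q] into parts of sizes [p] and [q], or
    merging cliques of sizes [p] and [q], costs [p * q] edits.  Such a move is
    written with [p + q - 1 <= p * q] digits, so that solutions with at most [k]
    edits correspond to strings of length [k]. *)
From HB Require Import structures.
From mathcomp Require Import all_classical all_reals all_analysis.
(* Imported last, so that [subsetP], [setUC], ... refer to finite sets. *)
From mathcomp Require Import all_boot all_order all_algebra zify lra.
Require Import Defs.

Set Implicit Arguments.
Unset Strict Implicit.
Unset Printing Implicit Defensive.

(** * Running times of machine programs *)

Lemma updE m a v : upd m a v a = v.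
Proof. by rewrite /upd eqxx. Qed.

Lemma updNE m a v x : x != a -> upd m a v x = m x.
Proof. by rewrite /upd => /negbTE ->. Qed.

Ltac upd_lia := repeat first [rewrite updE | rewrite updNE; [|lia]].

Definition changes (P : pred nat) (m m' : memory) : Prop :=
  forall y, ~~ P y -> m' y = m y.

Lemma changes_refl P m : changes P m m.
Proof. by []. Qed.

Lemma changes_sub (P P' : pred nat) m m' :
  subpred P P' -> changes P m m' -> changes P' m m'.
Proof. by move=> sP mm y nP; apply: mm; apply: contra nP; apply: sP. Qed.

Lemma changes_trans P m1 m2 m3 :
  changes P m1 m2 -> changes P m2 m3 -> changes P m1 m3.
Proof. by move=> m12 m23 y nP; rewrite m23 ?m12. Qed.

Lemma changes_upd (P : pred nat) m m' a v :
  P a -> changes P m m' -> changes P m (upd m' a v).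
Proof.
by move=> Pa mm y nP; rewrite updNE ?mm //; apply: contraNneq nP => ->.
Qed.

Definition runs (p : prog) (m : memory) (T : nat) (Q : memory -> Prop) : Prop :=
  exists t m', [/\ exec p m t m', t <= T & Q m'].

Lemma runs_mono p m T T' (Q Q' : memory -> Prop) :
  T <= T' -> (forall m', Q m' -> Q' m') -> runs p m T Q -> runs p m T' Q'.
Proof.
move=> TT QQ [t [m' [ex tT Qm]]]; exists t, m'; split=> //; last exact: QQ.
exact: leq_trans TT.
Qed.

Lemma runs_le p m T T' Q : T <= T' -> runs p m T Q -> runs p m T' Q.
Proof. by move=> TT; apply: runs_mono. Qed.

Lemma runs_exec p m t m' (Q : memory -> Prop) :
  exec p m t m' -> Q m' -> runs p m t Q.
Proof. by move=> ex Qm; exists t, m'. Qed.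

Lemma runs_Seq p q m T T' (R Q : memory -> Prop) :
  runs p m T R -> (forall m', R m' -> runs q m' T' Q) ->
  runs (Seq p q) m (T + T') Q.
Proof.
move=> [t [m' [ex tT Rm]]] /(_ _ Rm) [t' [m'' [ex' tT' Qm]]].
by exists (t + t'), m''; split=> //; [apply: exec_Seq ex ex' | exact: leq_add].
Qed.

Lemma runs_Seq_exec p q m t m' T Q :
  exec p m t m' -> runs q m' T Q -> runs (Seq p q) m (t + T) Q.
Proof. by move=> ex qQ; apply: runs_Seq (runs_exec ex erefl) _ => _ <-. Qed.

Lemma runs_If a p q m T Q :
  (m a != 0 -> runs p m T Q) -> (m a = 0 -> runs q m T Q) ->
  runs (If a p q) m T.+1 Q.
Proof.
move=> Hp Hq; case: (eqVneq (m a) 0) => ma.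
  have [t [m' [ex tT Qm]]] := Hq ma; exists t.+1, m'; split=> //.
  exact: exec_If_false.
have [t [m' [ex tT Qm]]] := Hp ma; exists t.+1, m'; split=> //.
exact: exec_If_true.
Qed.

Lemma runs_While a p T N (I : nat -> memory -> Prop) m :
  I 0 m ->
  (forall i m', i < N -> I i m' -> m' a != 0 /\ runs p m' T (I i.+1)) ->
  (forall m', I N m' -> m' a = 0) ->
  runs (While a p) m (N * T.+1).+1 (I N).
Proof.
move=> I0 IS IN.
suff from j m' : j <= N -> I (N - j) m' ->
    runs (While a p) m' (j * T.+1).+1 (I N).
  by apply: from; rewrite ?subnn.
elim: j m' => [|j IH] m' jN Im.
  rewrite subn0 in Im; exact: runs_exec (exec_While_false _ (IN _ Im)) Im.
have [ma [t [m1 [ex tT Im1]]]] := IS (N - j.+1) m' ltac:(lia) Im.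
have [|t' [m2 [ex' tT' Im2]]] := IH m1 (ltnW jN).
  by have -> : N - j = (N - j.+1).+1 by lia.
exists (t + t').+1, m2; split=> //; last by lia.
exact: exec_While_true ma ex ex'.
Qed.

(* Only cells can be subtracted, hence the scratch cell [u]. *)
Definition Repeat (c u : nat) (p : prog) : prog :=
  While c (Seq p (Seq (Const u 1) (Defs.Sub c c u))).

Lemma runs_Repeat c u p T (I : nat -> memory -> Prop) m :
  c != u -> I 0 m ->
  (forall i m', i < m c -> m' c = m c - i -> I i m' ->
     runs p m' T (fun m'' =>
       m'' c = m' c /\ I i.+1 (upd (upd m'' u 1) c (m'' c - 1)))) ->
  runs (Repeat c u p) m (m c * (T + 3)).+1 (I (m c)).
Proof.
move=> cu I0 IS; pose J i m' := m' c = m c - i /\ I i m'.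
have : runs (Repeat c u p) m (m c * (T + 2).+1).+1 (J (m c)).
  apply: runs_While => [|i m' im [m'c Ii]|m' [-> _]]; last by rewrite subnn.
    by split; rewrite ?subn0.
  split; first by rewrite m'c; lia.
  apply: runs_Seq (IS i m' im m'c Ii) _ => m1 [m1c Im].
  apply: runs_Seq_exec (exec_Const _ _ _) _.
  apply: runs_exec (exec_Sub _ _ _ _) _.
  by rewrite updE updNE //; split; rewrite ?updE //; lia.
by apply: runs_mono => [|m' []] //; lia.
Qed.

Definition AddConst (r K : nat) : prog := iter K (Seq (Succ r r)) Skip.

Lemma runs_AddConst r K m :
  runs (AddConst r K) m K.+1
    (fun m' => m' r = m r + K /\ changes (fun y => y == r) m m').
Proof.
elim: K m => [|K IH] m.
  by apply: runs_exec (exec_Skip _) _; rewrite addn0.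
apply: runs_Seq_exec (exec_Succ _ _ _) _.
apply: runs_mono (IH _) => // m' [m'r mm'].
split; first by rewrite m'r updE; lia.
by apply: changes_trans mm'; apply: changes_upd => //=.
Qed.

Definition AddMul (c u r K : nat) : prog := Repeat c u (AddConst r K).

Lemma runs_AddMul c u r K m : uniq [:: c; u; r] ->
  runs (AddMul c u r K) m (m c * (K + 4)).+1
    (fun m' => m' r = m r + m c * K /\
      changes (fun y => y \in [:: c; u; r]) m m').
Proof.
rewrite /= !inE => dist.
apply: (@runs_le _ _ (m c * (K.+1 + 3)).+1); first by lia.
apply: (@runs_Repeat c u (AddConst r K) K.+1 (fun i m' =>
  m' r = m r + i * K /\ changes (fun y => y \in [:: c; u; r]) m m')).
- by lia.
- by split; [lia | exact: changes_refl].
move=> i m' _ m'c [m'r mm'].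
apply: runs_mono (runs_AddConst r K m') => // m1 [m1r m'm1].
split; first by rewrite m'm1 //; lia.
split; first by upd_lia; lia.
do 2!(apply: changes_upd; first by rewrite !inE eqxx ?orbT).
apply: changes_trans mm' (changes_sub _ m'm1) => y /=.
by rewrite !inE => ->; rewrite !orbT.
Qed.

Definition AddProduct (c b t u r K : nat) : prog :=
  Repeat c u (Seq (Succ t b) (AddMul t u r K)).

Lemma runs_AddProduct c b t u r K m : uniq [:: c; b; t; u; r] ->
  runs (AddProduct c b t u r K) m (m c * ((m b).+1 * (K + 4) + 5)).+1
    (fun m' => m' r = m r + m c * ((m b).+1 * K) /\
               changes (fun y => y \in [:: c; t; u; r]) m m').
Proof.
move=> dist.
apply: (@runs_le _ _ (m c * (1 + ((m b).+1 * (K + 4)).+1 + 3)).+1).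
  by lia.
have /and5P[] := dist; rewrite !inE !negb_or.
case/and4P=> cb ct cu cr /and3P[bt bu br] _ _ _.
have utur : uniq [:: t; u; r] by case/and3P: dist.
apply: (@runs_Repeat c u _ _ (fun i m' => m' r = m r + i * ((m b).+1 * K) /\
  changes (fun y => y \in [:: c; t; u; r]) m m')) => //.
  by split; [rewrite addn0 | exact: changes_refl].
move=> i m' _ m'c [m'r mm'].
have m'b : m' b = m b by rewrite mm' // !inE !negb_or eq_sym cb bt bu.
apply: runs_Seq_exec (exec_Succ _ _ _) _.
apply: runs_mono (runs_AddMul K _ utur); rewrite updE m'b // => m1 [m1r m'm1].
have [tr ur] : t != r /\ u != r.
  by case/and3P: utur; rewrite !inE negb_or => /andP[].
split; first by rewrite m'm1 ?updNE // !inE !negb_or ct cu.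
split.
  rewrite !updNE ?[r == _]eq_sym // m1r.
  by rewrite updNE 1?eq_sym // m'r [i.+1 * _]mulSnr addnA.
do 2!(apply: changes_upd; first by rewrite !inE eqxx ?orbT).
apply: changes_trans (changes_upd (m b).+1 _ mm') (changes_sub _ m'm1).
  by rewrite !inE eqxx orbT.
by move=> y /=; rewrite !inE => ->; rewrite orbT.
Qed.

(** * A language of bounded loops and its compiler *)

Inductive var := Var of nat.
Definition var_id (x : var) : nat := let: Var i := x in i.
HB.instance Definition _ := [isNew for var_id].
HB.instance Definition _ := [Equality of var by <:].

Inductive array := Array of nat.
Definition array_id (a : array) : nat := let: Array i := a in i.
HB.instance Definition _ := [isNew for array_id].
HB.instance Definition _ := [Equality of array by <:].

Inductive expr :=
| EConst of nat
| EVar of var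
| ECap
| EAdd of expr & expr
| ESub of expr & expr
| EGet of array & expr & expr
| EInput of expr.

Inductive com :=
| CSkip
| CSet of var & expr
| CPut of array & expr & expr & expr
| CSeq of com & com
| CIf of expr & com & com
| CFor of var & expr & com.

Record store := Store { vget : var -> nat; aget : array -> nat -> nat -> nat }.

Definition vset (s : store) x v : store :=
  Store (fun y => if y == x then v else vget s y) (aget s).

Definition aset (s : store) a i j v : store :=
  Store (vget s) (fun b =>
    if b == a then fun i' j' =>
      if (i' == i) && (j' == j) then v else aget s a i' j'
    else aget s b).

Section Semantics.
Variables (W cap : nat) (inp : nat -> nat).

(* Sums, array indices and loop bounds are truncated at [cap], so that every
   command is total and takes time polynomial in [cap] whatever the data. *)
Fixpoint eval (s : store) (e : expr) : nat :=
  match e with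
  | EConst c => c
  | EVar x => vget s x
  | ECap => cap
  | EAdd e1 e2 => minn (eval s e1 + eval s e2) cap
  | ESub e1 e2 => eval s e1 - eval s e2
  | EGet a e1 e2 => aget s a (minn (eval s e1) cap) (minn (eval s e2) cap)
  | EInput e => if W <= eval s e < cap then inp (eval s e) else 0
  end.

Fixpoint run (c : com) (s : store) : store :=
  match c with
  | CSkip => s
  | CSet x e => vset s x (eval s e)
  | CPut a e1 e2 e3 =>
      aset s a (minn (eval s e1) cap) (minn (eval s e2) cap) (eval s e3)
  | CSeq c1 c2 => run c2 (run c1 s)
  | CIf e c1 c2 => if eval s e == 0 then run c2 s else run c1 s
  | CFor x e c =>
      iteri (minn (eval s e) cap) (fun i s' => run c (vset s' x i)) s
  end.

End Semantics.

Lemma mulnD_inj d q r q' r' : r < d -> r' < d -> q * d + r = q' * d + r' ->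
  q = q' /\ r = r'.
Proof.
move=> rd r'd e; have := congr1 (divn^~ d) e; have := congr1 (modn^~ d) e.
have d0 : 0 < d by lia.
rewrite /= !modnMDl !modn_small // !divnMDl // !divn_small // !addn0.
by move=> -> ->.
Qed.

Section Compiler.

(* Variables live in cells below [NV], the bound [cap] in cell [NV], temporaries
   in the cells up to [W].  The cells from [W] to [cap] still hold the input,
   and the [NA] two-dimensional arrays are interleaved from cell [cap] on. *)
Variables (NV NA W : nat).

Definition Truncate d : prog := Seq (Defs.Sub d NV d) (Defs.Sub d NV d).

Definition Address d a : prog :=
  Seq (Truncate d) (Seq (Truncate d.+1) (Seq (Copy d.+2 NV)
    (Seq (AddProduct d NV d.+3 d.+4 d.+2 NA)
      (Seq (AddMul d.+1 d.+4 d.+2 NA) (AddConst d.+2 a))))).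

Fixpoint compile_expr d e : prog :=
  match e with
  | EConst c => Const d c
  | EVar x => Copy d (var_id x)
  | ECap => Copy d NV
  | EAdd e1 e2 => Seq (compile_expr d e1) (Seq (compile_expr d.+1 e2)
      (Seq (Defs.Sub d NV d) (Seq (Defs.Sub d d d.+1) (Defs.Sub d NV d))))
  | ESub e1 e2 =>
      Seq (compile_expr d e1) (Seq (compile_expr d.+1 e2) (Defs.Sub d d d.+1))
  | EGet a e1 e2 => Seq (compile_expr d e1) (Seq (compile_expr d.+1 e2)
      (Seq (Address d (array_id a)) (Read d d.+2)))
  | EInput e => Seq (compile_expr d e)
      (Seq (Const d.+1 W) (Seq (Defs.Sub d.+1 d.+1 d)
        (If d.+1 (Const d 0)
          (Seq (Defs.Sub d.+1 NV d) (If d.+1 (Read d d) (Const d 0))))))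
  end.

Fixpoint compile d c : prog :=
  match c with
  | CSkip => Skip
  | CSet x e => Seq (compile_expr d e) (Copy (var_id x) d)
  | CPut a e1 e2 e3 => Seq (compile_expr d e3)
      (Seq (compile_expr d.+1 e1) (Seq (compile_expr d.+2 e2)
        (Seq (Address d.+1 (array_id a)) (Write d.+3 d))))
  | CSeq c1 c2 => Seq (compile d c1) (compile d c2)
  | CIf e c1 c2 => Seq (compile_expr d e) (If d (compile d c1) (compile d c2))
  | CFor x e c => Seq (compile_expr d e) (Seq (Truncate d) (Seq (Const d.+1 0)
      (Repeat d d.+2
        (Seq (Copy (var_id x) d.+1) (Seq (compile d.+2 c) (Succ d.+1 d.+1))))))
  end.

Fixpoint wf_expr d e : bool :=
  match e with
  | EConst _ | ECap => d < W
  | EVar x => (d < W) && (var_id x < NV)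
  | EAdd e1 e2 | ESub e1 e2 => wf_expr d e1 && wf_expr d.+1 e2
  | EGet a e1 e2 =>
      [&& d.+4 < W, array_id a < NA, wf_expr d e1 & wf_expr d.+1 e2]
  | EInput e => (d.+1 < W) && wf_expr d e
  end.

Fixpoint wf_com d c : bool :=
  match c with
  | CSkip => true
  | CSet x e => (var_id x < NV) && wf_expr d e
  | CPut a e1 e2 e3 => [&& d.+4.+1 < W, array_id a < NA, wf_expr d e3,
                           wf_expr d.+1 e1 & wf_expr d.+2 e2]
  | CSeq c1 c2 => wf_com d c1 && wf_com d c2
  | CIf e c1 c2 => [&& wf_expr d e, wf_com d c1 & wf_com d c2]
  | CFor x e c => [&& d.+2 < W, var_id x < NV, wf_expr d e & wf_com d.+2 c]
  end.

Lemma wf_expr_lt e d : wf_expr d e -> d < W.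
Proof.
elim: e d => [c|x||e1 IH1 e2 _|e1 IH1 e2 _|a e1 IH1 e2 _|e IH] d //=.
- by case/andP.
- by case/andP=> /IH1.
- by case/andP=> /IH1.
- by case/and4P=> _ _ /IH1.
- by case/andP=> _ /IH.
Qed.

Section Correctness.
Variables (cap : nat) (inp : nat -> nat).
Hypothesis NVW : NV < W.
Hypothesis Wcap : W <= cap.
Notation eval := (eval W cap inp).
Notation run := (run W cap inp).

Definition address_time a : nat :=
  5 + (cap * (cap.+1 * (NA + 4) + 5)).+1 + (cap * (NA + 4)).+1 + a.+1.

Fixpoint expr_time e : nat :=
  match e with
  | EConst _ | EVar _ | ECap => 1
  | EAdd e1 e2 => expr_time e1 + (expr_time e2 + 3)
  | ESub e1 e2 => expr_time e1 + (expr_time e2 + 1)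
  | EGet a e1 e2 =>
      expr_time e1 + (expr_time e2 + (address_time (array_id a) + 1))
  | EInput e => expr_time e + 6
  end.

Fixpoint com_time c : nat :=
  match c with
  | CSkip => 1
  | CSet x e => expr_time e + 1
  | CPut a e1 e2 e3 => expr_time e3 +
      (expr_time e1 + (expr_time e2 + (address_time (array_id a) + 1)))
  | CSeq c1 c2 => com_time c1 + com_time c2
  | CIf e c1 c2 => expr_time e + (com_time c1 + com_time c2).+1
  | CFor x e c => expr_time e + (3 + (cap * (com_time c + 5)).+1)
  end.

Definition address a i j : nat := cap + (i * cap.+1 + j) * NA + a.

Lemma address_inj a i j a' i' j' : a < NA -> a' < NA -> j <= cap -> j' <= cap ->
  address a i j = address a' i' j' -> [/\ a = a', i = i' & j = j'].
Proof.
move=> aN aN' jc jc' e.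
have [|] := @mulnD_inj NA (i * cap.+1 + j) a (i' * cap.+1 + j') a' aN aN'.
  by move: e; rewrite /address; lia.
by move=> /mulnD_inj[] // -> -> ->.
Qed.

Record represents (s : store) (m : memory) : Prop := Represents {
  rep_var x : var_id x < NV -> m (var_id x) = vget s x;
  rep_cap : m NV = cap;
  rep_array a i j : array_id a < NA -> i <= cap -> j <= cap ->
    m (address (array_id a) i j) = aget s a i j;
  rep_input y : W <= y < cap -> m y = inp y }.

Definition temporary d : pred nat := fun y => d <= y < W.

Lemma changes_temporary d d' m m' :
  d <= d' -> changes (temporary d') m m' -> changes (temporary d) m m'.
Proof. by move=> dd; apply: changes_sub => y; rewrite /temporary; lia. Qed.

Lemma changes_upd_temporary d d' m m' v : d <= d' < W ->
  changes (temporary d) m m' -> changes (temporary d) m (upd m' d' v).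
Proof. by move=> dd; apply: changes_upd. Qed.

Lemma represents_changes d s m m' :
  NV < d -> represents s m -> changes (temporary d) m m' -> represents s m'.
Proof.
rewrite /changes /temporary => dN [mv mc ma mi] mm; split=> *; rewrite mm; auto.
all: by rewrite ?/address; lia.
Qed.

Lemma runs_Truncate d m : NV < d -> m NV = cap ->
  runs (Truncate d) m 2 (fun m' =>
    m' d = minn (m d) cap /\ changes (fun y => y == d) m m').
Proof.
move=> dN mN; apply: (@runs_Seq_exec _ _ _ 1 _ 1 _ (exec_Sub _ _ _ _)).
apply: runs_exec (exec_Sub _ _ _ _) _.
split; first by upd_lia; rewrite mN; lia.
by do 2!apply: changes_upd => //.
Qed.

Lemma runs_Address d a m : NV < d -> d.+4 < W -> m NV = cap ->
  runs (Address d a) m (address_time a) (fun m' =>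
    m' d.+2 = address a (minn (m d) cap) (minn (m d.+1) cap) /\
    changes (temporary d) m m').
Proof.
move=> dN dW mN; set i := minn _ _; set j := minn _ _.
pose T1 := (i * (cap.+1 * (NA + 4) + 5)).+1; pose T2 := (j * (NA + 4)).+1.
apply: (@runs_le _ _ (2 + (2 + (1 + (T1 + (T2 + a.+1)))))).
  have : i * (cap.+1 * (NA + 4) + 5) <= cap * (cap.+1 * (NA + 4) + 5).
    by rewrite leq_mul2r geq_minr orbT.
  have : j * (NA + 4) <= cap * (NA + 4) by rewrite leq_mul2r geq_minr orbT.
  by rewrite /address_time /T1 /T2; lia.
apply: runs_Seq (runs_Truncate dN mN) _ => m1 [m1d m01].
apply: runs_Seq (runs_Truncate (leqW dN) _) _; first by rewrite m01; lia.
move=> m2 [m2d m12]; apply: runs_Seq_exec (exec_Copy _ _ _) _.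
set m3 := upd _ _ _.
have m3d : m3 d = i by rewrite /m3; upd_lia; rewrite m12 ?m1d; lia.
have m3d1 : m3 d.+1 = j by rewrite /m3; upd_lia; rewrite m2d m01; lia.
have m3N : m3 NV = cap by rewrite /m3; upd_lia; rewrite m12 ?m01; lia.
have m3d2 : m3 d.+2 = cap by rewrite /m3; upd_lia; rewrite m12 ?m01; lia.
have m03 : changes (temporary d) m m3.
  apply: changes_upd_temporary; first by lia.
  by move=> y /= yd; rewrite m12 ?m01 //; move: yd; rewrite /temporary; lia.
clearbody m3; clear m1 m2 m1d m01 m2d m12.
apply: runs_Seq.
  by rewrite /T1 -{1}m3d -m3N; apply: runs_AddProduct; rewrite /= !inE; lia.
move=> m4 [m4d2 m34]; have m4d1 : m4 d.+1 = j by rewrite m34 // !inE; lia.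
apply: runs_Seq.
  by rewrite /T2 -m4d1; apply: runs_AddMul; rewrite /= !inE; lia.
move=> m5 [m5d2 m45].
apply: runs_mono (runs_AddConst d.+2 a m5) => // m6 [m6d2 m56]; split.
  by rewrite m6d2 m5d2 m4d2 m3d m3d2 m3N m4d1 /address; lia.
apply: changes_trans m03 _ => y; rewrite /temporary => yd.
by rewrite m56 ?m45 ?m34 ?inE //; lia.
Qed.

Definition computes s d e : Prop := forall m, represents s m ->
  runs (compile_expr d e) m (expr_time e) (fun m' =>
    m' d = eval s e /\ changes (temporary d) m m').

Lemma runs_operands s d e1 e2 m p T Q : NV < d -> d < W ->
  computes s d e1 -> computes s d.+1 e2 -> represents s m ->
  (forall m', represents s m' -> m' d = eval s e1 -> m' d.+1 = eval s e2 ->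
     changes (temporary d) m m' -> runs p m' T Q) ->
  runs (Seq (compile_expr d e1) (Seq (compile_expr d.+1 e2) p)) m
    (expr_time e1 + (expr_time e2 + T)) Q.
Proof.
move=> dN dW c1 c2 r pQ.
apply: runs_Seq (c1 m r) _ => m1 [m1d m01].
have r1 := represents_changes dN r m01.
apply: runs_Seq (c2 m1 r1) _ => m2 [m2d m12].
apply: pQ => //; first exact: represents_changes (leqW dN) r1 m12.
  by rewrite m12 // /temporary; lia.
exact: changes_trans m01 (changes_temporary (leqnSn d) m12).
Qed.

Lemma computes_EAdd s d e1 e2 : NV < d -> d.+1 < W ->
  computes s d e1 -> computes s d.+1 e2 -> computes s d (EAdd e1 e2).
Proof.
move=> dN dW c1 c2 m r; apply: runs_operands r _ => //; first by lia.
move=> m1 r1 m1d m1d1 mm1.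
apply: (@runs_Seq_exec _ _ _ 1 _ (1 + 1) _ (exec_Sub _ _ _ _)).
apply: runs_Seq_exec (exec_Sub _ _ _ _) _.
apply: runs_exec (exec_Sub _ _ _ _) _.
split; first by upd_lia; rewrite m1d m1d1 (rep_cap r1) /=; lia.
by do !(apply: changes_upd_temporary; first by lia).
Qed.

Lemma computes_ESub s d e1 e2 : NV < d -> d.+1 < W ->
  computes s d e1 -> computes s d.+1 e2 -> computes s d (ESub e1 e2).
Proof.
move=> dN dW c1 c2 m r; apply: runs_operands r _ => //; first by lia.
move=> m1 r1 m1d m1d1 mm1; apply: runs_exec (exec_Sub _ _ _ _) _.
by rewrite updE m1d m1d1; split=> //; apply: changes_upd_temporary => //; lia.
Qed.

Lemma computes_EGet s d a e1 e2 : NV < d -> d.+4 < W -> array_id a < NA ->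
  computes s d e1 -> computes s d.+1 e2 -> computes s d (EGet a e1 e2).
Proof.
move=> dN dW aN c1 c2 m r; apply: runs_operands r _ => //; first by lia.
move=> m1 r1 m1d m1d1 mm1.
apply: runs_Seq (runs_Address _ dN dW (rep_cap r1)) _ => m2 [m2d2 m12].
apply: runs_exec (exec_Read _ _ _) _.
have r2 := represents_changes dN r1 m12; split.
  by rewrite updE m2d2 m1d m1d1 (rep_array r2) ?geq_minr.
apply: changes_upd_temporary; first by lia.
exact: changes_trans mm1 m12.
Qed.

Lemma computes_EInput s d e : NV < d -> d.+1 < W ->
  computes s d e -> computes s d (EInput e).
Proof.
move=> dN dW ce m r; apply: runs_Seq (ce m r) _ => m1 [m1d m01].
have r1 := represents_changes dN r m01.
apply: (@runs_Seq_exec _ _ _ 1 _ (1 + (1 + 2).+1) _ (exec_Const _ _ _)).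
apply: runs_Seq_exec (exec_Sub _ _ _ _) _; upd_lia; rewrite m1d /=.
set e1 := eval s e in m1d *.
apply: runs_If; rewrite updE => eW.
  apply: (@runs_le _ _ 1) => //; apply: runs_exec (exec_Const _ _ _) _.
  rewrite updE leqNgt (_ : e1 < W); last by lia.
  by split=> //; do !(apply: changes_upd_temporary; first by lia).
apply: (@runs_Seq_exec _ _ _ 1 _ 2 _ (exec_Sub _ _ _ _)); upd_lia.
rewrite m1d (rep_cap r1) (_ : W <= e1) /=; last by lia.
apply: runs_If; rewrite updE => ecap.
  set m2 := upd _ _ _; have m2d : m2 d = e1 by rewrite /m2; upd_lia.
  apply: runs_exec (exec_Read _ _ _) _; rewrite updE m2d /m2; upd_lia.
  rewrite (rep_input r1); last by lia.
  rewrite (_ : e1 < cap); last by lia.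
  by split=> //; do !(apply: changes_upd_temporary; first by lia).
apply: runs_exec (exec_Const _ _ _) _.
rewrite updE ltnNge (_ : cap <= e1); last by lia.
by split=> //; do !(apply: changes_upd_temporary; first by lia).
Qed.

Lemma compile_expr_correct e d s : NV < d -> wf_expr d e -> computes s d e.
Proof.
have upd_d d' m v : d' < W -> changes (temporary d') m (upd m d' v).
  by move=> dW; apply: changes_upd_temporary; rewrite ?leqnn.
elim: e d => [c|x||e1 IH1 e2 IH2|e1 IH1 e2 IH2|a e1 IH1 e2 IH2|e IH] d dN /=.
- move=> dW m r; apply: runs_exec (exec_Const _ _ _) _.
  by rewrite updE; split=> //; exact: upd_d.
- move=> /andP[dW xN] m r; apply: runs_exec (exec_Copy _ _ _) _.
  by rewrite updE (rep_var r) //; split=> //; exact: upd_d.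
- move=> dW m r; apply: runs_exec (exec_Copy _ _ _) _.
  by rewrite updE (rep_cap r); split=> //; exact: upd_d.
- move=> /andP[w1 w2].
  exact: computes_EAdd dN (wf_expr_lt w2) (IH1 d dN w1) (IH2 _ (leqW dN) w2).
- move=> /andP[w1 w2].
  exact: computes_ESub dN (wf_expr_lt w2) (IH1 d dN w1) (IH2 _ (leqW dN) w2).
- move=> /and4P[dW aN w1 w2].
  exact: computes_EGet dN dW aN (IH1 d dN w1) (IH2 _ (leqW dN) w2).
- by move=> /andP[dW we]; exact: computes_EInput dN dW (IH d dN we).
Qed.

Lemma represents_vset s m x v : var_id x < NV ->
  represents s m -> represents (vset s x v) (upd m (var_id x) v).
Proof.
move=> xN [mv mc ma mi]; split.
- by move=> y yN; rewrite /upd /= -val_eqE; case: ifP => _ //; exact: mv.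
- by rewrite updNE //; lia.
- by move=> a i j aN ic jc; rewrite updNE ?ma ?/address //; lia.
- by move=> y yW; rewrite updNE ?mi //; lia.
Qed.

Lemma represents_aset s m a i j v : array_id a < NA -> i <= cap -> j <= cap ->
  represents s m ->
  represents (aset s a i j v) (upd m (address (array_id a) i j) v).
Proof.
move=> aN ic jc [mv mc ma mi]; split.
- by move=> y yN; rewrite updNE ?mv ?/address //; lia.
- by rewrite updNE ?/address //; lia.
- move=> a' i' j' aN' ic' jc'; rewrite /upd /=; case: (eqVneq a' a) => [->|na].
    case: (eqVneq i' i) => [->|ni] /=; last first.
      by case: eqP => [/address_inj[]//|_]; [move/eqP: ni | exact: ma].
    case: (eqVneq j' j) => [->|nj]; first by rewrite eqxx.
    by case: eqP => [/address_inj[]//|_]; [move/eqP: nj | exact: ma].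
  case: eqP => [/address_inj[]//|_]; last exact: ma.
  by move/val_inj/eqP; rewrite (negbTE na).
- by move=> y yW; rewrite updNE ?mi ?/address //; lia.
Qed.

Definition executes d c : Prop := forall s m, represents s m ->
  runs (compile d c) m (com_time c) (fun m' =>
    represents (run c s) m' /\ changes (fun y => (y < NV) || (d <= y)) m m').

Lemma executes_CPut d a e1 e2 e3 : NV < d ->
  wf_com d (CPut a e1 e2 e3) -> executes d (CPut a e1 e2 e3).
Proof.
move=> dN /and5P[dW aN w3 w1 w2] s m r.
apply: runs_Seq (compile_expr_correct dN w3 r) _ => m1 [m1d m01].
have r1 := represents_changes dN r m01.
apply: (runs_operands (leqW dN) _ (compile_expr_correct (leqW dN) w1)
  (compile_expr_correct (leqW (leqW dN)) w2) r1) => [|m2 r2 m2d1 m2d2 m12].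
  by lia.
apply: runs_Seq; first by apply: runs_Address (rep_cap r2); lia.
move=> m3 [m3d3 m23]; apply: runs_exec (exec_Write _ _ _) _.
have m3d : m3 d = eval s e3 by rewrite m23 ?m12 // /temporary; lia.
rewrite m3d3 m3d m2d1 m2d2; split.
  apply: represents_aset; rewrite ?geq_minr //.
  exact: represents_changes (leqW dN) r2 m23.
apply: changes_upd; first by rewrite /address; lia.
by move=> y yd; rewrite m23 ?m12 ?m01 // /temporary; lia.
Qed.

Lemma executes_CIf d e c1 c2 : NV < d -> wf_expr d e ->
  executes d c1 -> executes d c2 -> executes d (CIf e c1 c2).
Proof.
move=> dN we x1 x2 s m r /=.
apply: runs_Seq (compile_expr_correct dN we r) _ => m1 [m1d m01].
have r1 := represents_changes dN r m01.
have mm1 : changes (fun y => (y < NV) || (d <= y)) m m1.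
  by apply: changes_sub m01 => y; rewrite /temporary; lia.
apply: runs_If; rewrite m1d /= => e0.
  rewrite (negbTE e0).
  apply: runs_mono (x1 s m1 r1) => [|m2 [r2 m12]]; first by lia.
  by split=> //; exact: changes_trans mm1 m12.
rewrite e0 eqxx; apply: runs_mono (x2 s m1 r1) => [|m2 [r2 m12]]; first by lia.
by split=> //; exact: changes_trans mm1 m12.
Qed.

Lemma executes_CFor d x e c : NV < d -> d.+2 < W -> var_id x < NV ->
  wf_expr d e -> executes d.+2 c -> executes d (CFor x e c).
Proof.
move=> dN dW xN we xc s m r /=.
apply: runs_Seq (compile_expr_correct dN we r) _ => m1 [m1d m01].
have r1 := represents_changes dN r m01; set N := minn _ cap.
apply: (@runs_le _ _ (2 + (1 + (N * (com_time c + 2 + 3)).+1))).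
  have : N * (com_time c + 5) <= cap * (com_time c + 5).
    by rewrite leq_mul2r geq_minr orbT.
  by lia.
apply: runs_Seq (runs_Truncate dN (rep_cap r1)) _ => m2 [m2d m12].
rewrite m1d -/N in m2d; apply: runs_Seq_exec (exec_Const _ _ _) _.
set m3 := upd m2 _ _; have m3d : m3 d = N by rewrite /m3; upd_lia.
have m13 : changes (temporary d) m1 m3.
  apply: changes_upd_temporary; first by lia.
  by apply: changes_sub m12 => y /= /eqP ->; rewrite /temporary; lia.
pose I i (m' : memory) := [/\ m' d.+1 = i,
  represents (iteri i (fun i s' => run c (vset s' x i)) s) m'
  & changes (fun y => (y < NV) || (d <= y)) m m'].
rewrite -m3d.
apply: runs_mono (runs_Repeat (T := com_time c + 2) (I := I) _ _ _) => //.
- by move=> m' [].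
- by lia.
- split; [by rewrite /m3 updE | exact: represents_changes r1 m13 |].
  by move=> y yd; rewrite m13 ?m01 // /temporary; lia.
move=> i m' _ m'd [m'd1 r' mm'].
apply: (@runs_le _ _ (1 + (com_time c + 1))); first by lia.
apply: runs_Seq_exec (exec_Copy _ _ _) _; rewrite m'd1.
apply: runs_Seq (xc _ _ (represents_vset i xN r')) _ => m4 [r4 m'4].
apply: runs_exec (exec_Succ _ _ _) _.
have m4d : m4 d = m' d by rewrite m'4; upd_lia; lia.
have m4d1 : m4 d.+1 = i by rewrite m'4; upd_lia; lia.
split; first by upd_lia; rewrite m4d.
split; first by upd_lia; rewrite m4d1.
  rewrite iteriS; apply: represents_changes dN r4 _.
  by do 3!(apply: changes_upd_temporary; first by lia); exact: changes_refl.
do 3!(apply: changes_upd; first by lia).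
by move=> y yd; rewrite m'4 ?updNE ?mm' //; lia.
Qed.

Lemma compile_correct c d : NV < d -> wf_com d c -> executes d c.
Proof.
elim: c d => [|x e|a e1 e2 e3|c1 IH1 c2 IH2|e c1 IH1 c2 IH2|x e c IH] d dN.
- by move=> _ s m r; exact: runs_exec (exec_Skip _) _.
- move=> /andP[xN we] s m r /=.
  apply: runs_Seq (compile_expr_correct dN we r) _ => m1 [m1d m01].
  apply: runs_exec (exec_Copy _ _ _) _; rewrite m1d; split.
    exact/represents_vset/(represents_changes dN r m01).
  apply: changes_upd; first by lia.
  by apply: changes_sub m01 => y; rewrite /temporary; lia.
- exact: executes_CPut.
- move=> /andP[w1 w2] s m r /=.
  apply: runs_Seq (IH1 d dN w1 s m r) _ => m1 [r1 m01].
  apply: runs_mono (IH2 d dN w2 _ m1 r1) => // m2 [r2 m12]; split=> //.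
  exact: changes_trans m01 m12.
- by move=> /and3P[we w1 w2]; apply: executes_CIf; auto.
- move=> /and4P[dW xN we wc]; apply: executes_CFor => //.
  by apply: IH => //; lia.
Qed.

End Correctness.
End Compiler.

Definition poly_bounded (f : nat -> nat) : Prop :=
  exists C, forall x, f x <= C * x.+1 ^ C.

Lemma poly_bounded_cst c : poly_bounded (fun=> c).
Proof. by exists c => x; rewrite leq_pmulr // expn_gt0. Qed.

Lemma poly_bounded_id : poly_bounded id.
Proof. by exists 1 => x; rewrite mul1n expn1. Qed.

Lemma poly_boundedD f g :
  poly_bounded f -> poly_bounded g -> poly_bounded (fun x => f x + g x).
Proof.
move=> [C fC] [D gD]; exists (C + D) => x; rewrite mulnDl; apply: leq_add.
  by apply: leq_trans (fC x) _; rewrite leq_mul2l leq_pexp2l ?orbT ?leq_addr.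
by apply: leq_trans (gD x) _; rewrite leq_mul2l leq_pexp2l ?orbT ?leq_addl.
Qed.

Lemma poly_boundedM f g :
  poly_bounded f -> poly_bounded g -> poly_bounded (fun x => f x * g x).
Proof.
move=> [C fC] [D gD]; exists (C * D + (C + D)) => x.
apply: leq_trans (leq_mul (fC x) (gD x)) _; rewrite mulnACA -expnD.
by apply: leq_mul; rewrite ?leq_addr // leq_pexp2l ?leq_addl.
Qed.

Lemma poly_boundedS f : poly_bounded f -> poly_bounded (fun x => (f x).+1).
Proof.
move=> /(poly_boundedD (poly_bounded_cst 1)) [C fC].
by exists C => x; exact: fC.
Qed.

Ltac poly := repeat first
  [ exact: poly_bounded_cst | exact: poly_bounded_id | solve [auto]
  | apply: poly_boundedS | apply: poly_boundedD | apply: poly_boundedM ].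

Lemma poly_bounded_address_time NA a :
  poly_bounded (fun cap => address_time NA cap a).
Proof. by rewrite /address_time; poly. Qed.

Lemma poly_bounded_expr_time NA e :
  poly_bounded (fun cap => expr_time NA cap e).
Proof.
have address_poly := poly_bounded_address_time NA.
by elim: e => [c|x||e1 IH1 e2 IH2|e1 IH1 e2 IH2|a e1 IH1 e2 IH2|e IH] /=; poly.
Qed.

Lemma poly_bounded_com_time NA c : poly_bounded (fun cap => com_time NA cap c).
Proof.
have address_poly := poly_bounded_address_time NA.
have expr_poly := poly_bounded_expr_time NA.
by elim: c => [|x e|a e1 e2 e3|c1 IH1 c2 IH2|e c1 IH1 c2 IH2|x e c IH] /=; poly.
Qed.

Fixpoint mod_vars c : seq var :=
  match c with
  | CSkip | CPut _ _ _ _ => [::]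
  | CSet x _ => [:: x]
  | CSeq c1 c2 | CIf _ c1 c2 => mod_vars c1 ++ mod_vars c2
  | CFor x _ c => x :: mod_vars c
  end.

Fixpoint mod_arrays c : seq array :=
  match c with
  | CSkip | CSet _ _ => [::]
  | CPut a _ _ _ => [:: a]
  | CSeq c1 c2 | CIf _ c1 c2 => mod_arrays c1 ++ mod_arrays c2
  | CFor _ _ c => mod_arrays c
  end.

Record frame (c : com) (s s' : store) : Prop := Frame {
  frame_var x : x \notin mod_vars c -> vget s' x = vget s x;
  frame_array a : a \notin mod_arrays c -> aget s' a = aget s a }.

Section Runs.
Variables (W cap : nat) (inp : nat -> nat).
Notation eval := (eval W cap inp).
Notation run := (run W cap inp).

Lemma run_frame c s : frame c s (run c s).
Proof.
elim: c s => [|x e|a e1 e2 e3|c1 IH1 c2 IH2|e c1 IH1 c2 IH2|x e c IH] s //=.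
- by split=> //= y; rewrite inE => /negbTE ->.
- by split=> //= b; rewrite inE => /negbTE ->.
- have [v1 a1] := IH1 s; have [v2 a2] := IH2 (run c1 s).
  by split=> [y|a] /=; rewrite mem_cat negb_or => /andP[n1 n2];
    rewrite ?v2 ?v1 ?a2 ?a1.
- have [v1 a1] := IH1 s; have [v2 a2] := IH2 s.
  by split=> [y|a] /=; rewrite mem_cat negb_or => /andP[n1 n2];
    case: ifP; rewrite ?v2 ?v1 ?a2 ?a1.
- elim: (minn _ _) => [//|N [v1 a1]]; rewrite iteriS.
  have [v2 a2] := IH (vset (iteri N (fun i s' => run c (vset s' x i)) s) x N).
  split=> [y|a] /= nP; last by rewrite a2 // a1.
  by have := nP; rewrite inE negb_or => /andP[/negbTE yx yc];
    rewrite v2 //= yx v1.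
Qed.

Lemma run_var c s x : x \notin mod_vars c -> vget (run c s) x = vget s x.
Proof. by move/(frame_var (run_frame c s)). Qed.

Lemma run_array c s a : a \notin mod_arrays c -> aget (run c s) a = aget s a.
Proof. by move/(frame_array (run_frame c s)). Qed.

Lemma run_CSeq c1 c2 s : run (CSeq c1 c2) s = run c2 (run c1 s).
Proof. by []. Qed.

Lemma run_CIf e c1 c2 s :
  run (CIf e c1 c2) s = if eval s e == 0 then run c2 s else run c1 s.
Proof. by []. Qed.

Lemma run_CFor x e c s N (I : nat -> store -> Prop) :
  eval s e = N -> N <= cap -> I 0 s ->
  (forall i s', i < N -> frame (CFor x e c) s s' -> I i s' ->
     I i.+1 (run c (vset s' x i))) ->
  I N (run (CFor x e c) s).
Proof.
move=> eN Ncap I0 IS /=; rewrite eN (minn_idPl Ncap).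
suff: forall M, M <= N -> I M (iteri M (fun i s' => run c (vset s' x i)) s).
  by apply.
elim=> [|M IM] ltMN //; apply: IS => //; last exact/IM/ltnW.
have := run_frame (CFor x (EConst M) c) s.
by case=> /=; rewrite (minn_idPl _) //; lia.
Qed.

Lemma run_CFor_enum n x e c s (I : seq 'I_n -> store -> Prop) :
  eval s e = n -> n <= cap -> I [::] s ->
  (forall p (i : 'I_n) s', size p = i -> frame (CFor x e c) s s' -> I p s' ->
     I (rcons p i) (run c (vset s' x i))) ->
  I (enum 'I_n) (run (CFor x e c) s).
Proof.
move=> en ncap I0 IS; rewrite -(take_size (enum 'I_n)) size_enum_ord.
apply: (run_CFor (I := fun i => I (take i (enum 'I_n)))) => //.
  by rewrite take0.
move=> i s' lt_in fr Ii; pose i' := Ordinal lt_in.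
rewrite (take_nth i') ?size_enum_ord // (nth_ord_enum i' i').
by apply: IS => //; rewrite size_takel ?size_enum_ord // ltnW.
Qed.

End Runs.

(** * Labellings, splits and merges *)

Lemma card_sum (T : finType) (A : {pred T}) : #|A| = \sum_x (x \in A).
Proof. by rewrite -sum1_card big_mkcond. Qed.

Section Labellings.
Variable V : finType.
Implicit Types (a : rel V) (f g h : V -> nat).

(* A cluster graph is given by a labelling of the vertices whose fibres are the
   cliques.  Disagreements are ordered pairs, so each edit counts twice. *)
Definition same f : rel V := fun x y => f x == f y.

Definition disagreements a f : nat :=
  \sum_x \sum_y ((x != y) && (a x y (+) same f x y)).

Definition fibre f z : {set V} := [set x | f x == z].

Definition block_size f x : nat := #|fibre f (f x)|.

(* The profile counts vertices, not blocks, so that no division is needed. *)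
Definition profile f s : nat := #|[set x | block_size f x == s]|.

Lemma eq_disagreements a a' f f' :
  (forall x y, x != y -> a x y = a' x y) -> same f =2 same f' ->
  disagreements a f = disagreements a' f'.
Proof.
move=> aa ff; apply: eq_bigr => x _; apply: eq_bigr => y _.
by case: eqVneq => //= xy; rewrite aa // ff.
Qed.

Lemma disagreements_sameC f g :
  disagreements (same f) g = disagreements (same g) f.
Proof. by apply: eq_bigr => x _; apply: eq_bigr => y _; rewrite addbC. Qed.

Lemma disagreements_same f : disagreements (same f) f = 0.
Proof.
by rewrite /disagreements big1 // => x _; rewrite big1 // => y _;
  rewrite addbb andbF.
Qed.

Lemma disagreements_gt0 a f : 0 < disagreements a f ->
  exists x y, x != y /\ a x y != same f x y.
Proof.
rewrite lt0n sum_nat_eq0 negb_forall => /existsP[x].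
rewrite /= sum_nat_eq0 negb_forall => /existsP[y].
rewrite /= eqb0 negbK => /andP[xy axy].
by exists x, y; rewrite xy -negb_add negbK.
Qed.

Lemma disagreements_eq0 f g :
  disagreements (same g) f = 0 -> same f =2 same g.
Proof.
move=> /eqP; rewrite sum_nat_eq0 => /forallP eq0 x y.
have := eq0 x; rewrite /= sum_nat_eq0 => /forallP/(_ y).
by rewrite /= eqb0 /same; case: (eqVneq x y) => [->|_];
  rewrite ?eqxx //= negb_add => /eqP.
Qed.

Lemma eq_block_size f g : same f =2 same g -> block_size f =1 block_size g.
Proof.
move=> fg x; apply: eq_card => y; rewrite !inE.
exact: (fg y x).
Qed.

Lemma eq_profile f g : same f =2 same g -> profile f =1 profile g.
Proof.
by move=> fg s; apply: eq_card => x; rewrite !inE (eq_block_size fg).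
Qed.

Lemma eq_same f g : f =1 g -> same f =2 same g.
Proof. by move=> fg x y; rewrite /same !fg. Qed.

Lemma block_size_gt0 f x : 0 < block_size f x.
Proof. by apply/card_gt0P; exists x; rewrite inE. Qed.

Lemma block_size_le f x : block_size f x <= #|V|.
Proof. exact: max_card. Qed.

Lemma profile_le f s : profile f s <= #|V|.
Proof. exact: max_card. Qed.

Lemma profile_gt0P f s :
  reflect (exists x, block_size f x = s) (0 < profile f s).
Proof.
apply: (iffP card_gt0P) => [[x]|[x fx]]; first by rewrite inE => /eqP; exists x.
by exists x; rewrite inE fx.
Qed.

Definition collapse z b h : V -> nat := fun x => if h x == z then b else h x.

Section Collapse.
Variables (h : V -> nat) (z b : nat).
Hypothesis zb : z != b.
Let p := #|fibre h z|.
Let q := #|fibre h b|.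
Let f := collapse z b h.

Lemma card_fibre_collapse : #|fibre f b| = p + q.
Proof.
rewrite /p /q !card_sum -big_split; apply: eq_bigr => x _ /=.
rewrite !inE /f /collapse; case: (eqVneq (h x) z) => [->|] //.
by rewrite eqxx (negbTE zb).
Qed.

Lemma block_size_collapse x :
  block_size f x = if (h x == z) || (h x == b) then p + q else block_size h x.
Proof.
case: ifPn => [hx|]; first rewrite -card_fibre_collapse /block_size.
  congr #|pred_of_set (fibre _ _)|; rewrite /f /collapse.
  by case: ifP hx => //= _ /eqP.
rewrite negb_or => /andP[hz hb]; apply: eq_card => y; rewrite !inE /f /collapse.
rewrite (negbTE hz); case: (eqVneq (h y) z) => [->|//].
by rewrite eq_sym (negbTE hb) eq_sym (negbTE hz).
Qed.

Lemma profile_collapse s :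
  profile f s + (p == s) * p + (q == s) * q =
  profile h s + (p + q == s) * (p + q).
Proof.
have fibreM c w : c * #|fibre h w| = \sum_x c * (h x == w).
  by rewrite card_sum big_distrr; apply: eq_bigr => x _; rewrite inE.
have p_sum c : c * p = \sum_x c * (h x == z) by exact: fibreM.
have q_sum c : c * q = \sum_x c * (h x == b) by exact: fibreM.
rewrite mulnDr !p_sum !q_sum /profile !card_sum -!big_split /=.
apply: eq_bigr => x _; rewrite !inE block_size_collapse.
case: (eqVneq (h x) z) => [hz|hz] /=.
  by rewrite (_ : block_size h x = p) ?hz ?(negbTE zb) /block_size ?hz //; lia.
case: (eqVneq (h x) b) => [hb|hb] /=; last by lia.
by rewrite (_ : block_size h x = q) /block_size ?hb //; lia.
Qed.

Let cross x y : bool := (h x == z) && (h y == b) || (h x == b) && (h y == z).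

Lemma same_collapse x y : same f x y = same h x y || cross x y.
Proof.
rewrite /cross /same /f /collapse.
case: (eqVneq (h x) z) => [->|hx]; case: (eqVneq (h y) z) => [->|hy] /=.
- by rewrite !eqxx.
- by rewrite eq_sym andbF orbF.
- by rewrite (negbTE hx) andbT.
- by rewrite !andbF orbF.
Qed.

Lemma cross_apart x y : cross x y -> x != y /\ ~~ same h x y.
Proof.
rewrite /cross /same => /orP[]/andP[/eqP hx /eqP hy]; rewrite hx hy.
  by split=> //; apply: contraNneq zb => xy; rewrite -hx -hy xy.
split; last by rewrite eq_sym.
by apply: contraNneq zb => xy; rewrite -hx -hy xy.
Qed.

Lemma sum_cross : \sum_x \sum_y cross x y = 2 * (p * q).
Proof.
have prod w w' : #|fibre h w| * #|fibre h w'| =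
    \sum_x \sum_y ((h x == w) && (h y == w')).
  rewrite !card_sum big_distrlr /=.
  by apply: eq_bigr => x _; apply: eq_bigr => y _; rewrite !inE mulnb.
rewrite mul2n -addnn {2}[p * q]mulnC !prod -big_split; apply: eq_bigr => x _ /=.
rewrite -big_split; apply: eq_bigr => y _ /=; rewrite /cross.
by case: (eqVneq (h x) z) => [->|]; rewrite ?(negbTE zb) ?orbF ?addn0.
Qed.

Lemma disagreements_collapse a :
  disagreements a f <= disagreements a h + 2 * (p * q) /\
  disagreements a h <= disagreements a f + 2 * (p * q).
Proof.
rewrite -sum_cross /disagreements -!big_split /=.
split; apply: leq_sum => x _; rewrite -big_split; apply: leq_sum => y _ /=;
  rewrite same_collapse;
  by case: (cross x y); case: (same h x y); case: (_ != _); case: (a x y).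
Qed.

Lemma disagreements_collapse_apart a : (forall x y, cross x y -> ~~ a x y) ->
  disagreements a f = disagreements a h + 2 * (p * q).
Proof.
move=> apart; rewrite -sum_cross -big_split; apply: eq_bigr => x _ /=.
rewrite -big_split; apply: eq_bigr => y _ /=; rewrite same_collapse.
case: (boolP (cross x y)) => [cr|]; last by rewrite orbF addn0.
by have [-> /negbTE ->] := cross_apart cr; rewrite (negbTE (apart _ _ cr)).
Qed.

Lemma disagreements_collapse_together a : (forall x y, cross x y -> a x y) ->
  disagreements a h = disagreements a f + 2 * (p * q).
Proof.
move=> together; rewrite -sum_cross -big_split; apply: eq_bigr => x _ /=.
rewrite -big_split; apply: eq_bigr => y _ /=; rewrite same_collapse.
case: (boolP (cross x y)) => [cr|]; last by rewrite orbF addn0.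
by have [-> /negbTE ->] := cross_apart cr; rewrite together.
Qed.

End Collapse.

Definition splits p q f h : Prop :=
  exists z b, [/\ z != b, #|fibre h z| = p, #|fibre h b| = q
                & same f =2 same (collapse z b h)].

Lemma splits_collapse h z b : z != b ->
  splits #|fibre h z| #|fibre h b| (collapse z b h) h.
Proof. by move=> zb; exists z, b. Qed.

Lemma profile_splits p q f h s : splits p q f h ->
  profile f s + (p == s) * p + (q == s) * q =
  profile h s + (p + q == s) * (p + q).
Proof.
by move=> [z [b [zb <- <- /eq_profile ->]]]; exact: profile_collapse.
Qed.

Lemma disagreements_splits p q f h a : splits p q f h ->
  disagreements a f <= disagreements a h + 2 * (p * q) /\
  disagreements a h <= disagreements a f + 2 * (p * q).
Proof.
move=> [z [b [zb <- <- fh]]]; rewrite (@eq_disagreements a a f _ _ fh) //.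
exact: disagreements_collapse.
Qed.

Lemma exists_fresh f : exists z, forall x, f x != z.
Proof.
exists (\sum_x f x).+1 => x; rewrite neq_ltn ltnS.
by rewrite (bigD1 x) //= leq_addr.
Qed.

Lemma exists_split p q f : 0 < p -> 0 < q -> 0 < profile f (p + q) ->
  exists h, splits p q f h.
Proof.
move=> p0 q0 /profile_gt0P[x fx]; have [z fz] := exists_fresh f.
have [|s [s_uniq s_size s_fx]] := @card_geqP _ (fibre f (f x)) p _.
  by rewrite -[#|_|]/(block_size f x) fx leq_addr.
pose h y := if y \in s then z else f y.
have hz : #|fibre h z| = p.
  rewrite -s_size -(card_uniqP s_uniq); apply: eq_card => y; rewrite inE /h.
  by case: ifP => _; rewrite ?eqxx // (negbTE (fz y)).
have zb : z != f x by rewrite eq_sym.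
have fh : f =1 collapse z (f x) h.
  move=> y; rewrite /collapse /h; case: (boolP (y \in s)) => [ys|_].
    by have := s_fx y ys; rewrite eqxx inE => /eqP.
  by rewrite (negbTE (fz y)).
exists h, z, (f x); split=> //; last exact: eq_same.
have := card_fibre_collapse h zb; rewrite hz => /eqP.
rewrite (_ : #|_| = p + q) ?eqn_add2l; first by rewrite eq_sym => /eqP.
by rewrite -fx; apply: eq_card => y; rewrite !inE -fh.
Qed.

Lemma exists_merge p q h : 0 < p -> 0 < q ->
  p <= profile h p -> q <= profile h q - (p == q) * p ->
  exists f, splits p q f h.
Proof.
move=> p0 q0 hp hq.
suff [x [y [hxy <- <-]]] : exists x y,
    [/\ h x != h y, block_size h x = p & block_size h y = q].
  by exists (collapse (h x) (h y) h); exact: splits_collapse.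
have /profile_gt0P[x bx] := leq_trans p0 hp.
have [eq_pq|ne_pq] := eqVneq p q; last first.
  have /profile_gt0P[y yq] : 0 < profile h q by lia.
  exists x, y; split=> //; apply: contraNneq ne_pq => hxy.
  by rewrite -bx -yq /block_size hxy.
case: (boolP [exists y, (block_size h y == p) && (h x != h y)]).
  by case/existsP=> y /andP[/eqP yp hxy]; exists x, y; rewrite -eq_pq.
rewrite negb_exists => /forallP same_block.
have : profile h p <= block_size h x.
  apply/subset_leq_card/subsetP => y; rewrite !inE => yp.
  by have := same_block y; rewrite yp negbK eq_sym.
by rewrite bx; move: hq; rewrite -eq_pq eqxx; lia.
Qed.

Lemma splits_towards f g x y : f x = f y -> g x != g y ->
  exists p q h, [/\ 0 < p, 0 < q, splits p q f h &
    disagreements (same g) f = disagreements (same g) h + 2 * (p * q)].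
Proof.
move=> fxy gxy; have [z fz] := exists_fresh f.
pose h u := if (f u == f x) && (g u == g x) then z else f u.
have zb : z != f x by rewrite eq_sym.
have fh : f =1 collapse z (f x) h.
  move=> u; rewrite /collapse /h.
  by case: (boolP (_ && _)) => [/andP[/eqP -> _]|_];
    rewrite ?eqxx // (negbTE (fz u)).
have hz u : h u == z -> g u = g x.
  by rewrite /h; case: ifP => [/andP[_ /eqP]|_] //; rewrite (negbTE (fz u)).
have hb u : h u == f x -> g u != g x.
  rewrite /h; case: ifPn => [_|]; first by rewrite (negbTE zb).
  by rewrite negb_and => /orP[/negbTE ->|].
exists #|fibre h z|, #|fibre h (f x)|, h; split.
- by apply/card_gt0P; exists x; rewrite inE /h !eqxx.
- apply/card_gt0P; exists y.
  by rewrite inE /h fxy [g y == _]eq_sym (negbTE gxy) andbF.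
- by exists z, (f x); split=> //; exact: eq_same.
rewrite (eq_disagreements (a' := same g) _ (eq_same fh)) //.
apply: disagreements_collapse_apart => // u v; rewrite /same.
by case/orP=> /andP[]; [move=> /hz -> /hb | move=> /hb + /hz ->];
  rewrite // eq_sym.
Qed.

Lemma merges_towards f g x y : (forall u v, f u = f v -> g u = g v) ->
  f x != f y -> g x = g y ->
  exists p q h, [/\ 0 < p, 0 < q, splits p q h f &
    disagreements (same g) f = disagreements (same g) h + 2 * (p * q)].
Proof.
move=> fg fxy gxy.
exists (block_size f x), (block_size f y), (collapse (f x) (f y) f).
split; try exact: block_size_gt0; first exact: splits_collapse.
apply: disagreements_collapse_together => // u v; rewrite /same.
by case/orP=> /andP[/eqP/fg -> /eqP/fg ->]; rewrite gxy.
Qed.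

Lemma move_towards f g : 0 < disagreements (same g) f ->
  exists p q h, [/\ 0 < p, 0 < q, splits p q f h \/ splits p q h f &
    disagreements (same g) f = disagreements (same g) h + 2 * (p * q)].
Proof.
move=> /disagreements_gt0[x [y [_ neq]]].
case: (boolP [exists u, exists v, (f u == f v) && (g u != g v)]) => [|refines].
  case/existsP=> u /existsP[v /andP[/eqP fuv guv]].
  have [p [q [h [p0 q0 fh e]]]] := splits_towards fuv guv.
  by exists p, q, h; split=> //; left.
have fg u v : f u = f v -> g u = g v.
  move=> fuv; apply: contraNeq refines => guv.
  by apply/existsP; exists u; apply/existsP; exists v; rewrite fuv eqxx.
have [fxy gxy] : f x != f y /\ g x = g y.
  move: neq; rewrite /same; case: (eqVneq (f x) (f y)) => [/fg ->|_].
    by rewrite eqxx.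
  by rewrite eqbF_neg negbK => /eqP.
have [p [q [h [p0 q0 hf e]]]] := merges_towards fg fxy gxy.
by exists p, q, h; split=> //; right.
Qed.

End Labellings.

(** * Induced paths on three vertices *)

Section LastSome.
Variables (T : eqType) (R : Type) (F : T -> option R).

Definition last_some (s : seq T) : option R :=
  foldl (fun r x => oapp Some r (F x)) None s.

Lemma last_some_rcons s x :
  last_some (rcons s x) = oapp Some (last_some s) (F x).
Proof. by rewrite /last_some foldl_rcons. Qed.

Lemma last_some_mem s r : last_some s = Some r ->
  exists2 x, x \in s & F x = Some r.
Proof.
elim/last_ind: s => [//|s x IH]; rewrite last_some_rcons.
case Fx: (F x) => [r'|] /= e.
  by exists x; rewrite ?mem_rcons ?mem_head ?Fx.
by have [y ys Fy] := IH e; exists y; rewrite // mem_rcons inE ys orbT.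
Qed.

Lemma last_some_none s x : last_some s = None -> x \in s -> F x = None.
Proof.
elim/last_ind: s => [//|s y IH]; rewrite last_some_rcons mem_rcons inE.
by case Fy: (F y) => [r|] //= /IH xs /predU1P[->|/xs].
Qed.

End LastSome.

Section Graphs.
Variable V : finType.
Implicit Types (a : rel V) (f : V -> nat) (x y z : V).

Definition simple_graph a : Prop := symmetric a /\ irreflexive a.

Definition same_pair x y : rel V :=
  fun u v => (u == x) && (v == y) || (u == y) && (v == x).

Definition toggle a x y : rel V := fun u v => a u v (+) same_pair x y u v.

Lemma simple_toggle a x y : x != y -> simple_graph a ->
  simple_graph (toggle a x y).
Proof.
move=> xy [sym irr]; split=> [u v|u]; rewrite /toggle /same_pair.
  by rewrite sym orbC ![(v == _) && _]andbC.
by rewrite irr; case: (eqVneq u x) => [->|_] /=; rewrite ?(negbTE xy) ?andbF.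
Qed.

Lemma sum_same_pair x y : x != y -> \sum_u \sum_v same_pair x y u v = 2.
Proof.
move=> xy; rewrite pair_bigA /=; have := cards2 (x, y) (y, x).
rewrite xpair_eqE (negbTE xy) /= card_sum => <-.
by apply: eq_bigr => -[u v] _; rewrite !inE.
Qed.

Lemma disagreements_toggle_le a x y f : x != y ->
  disagreements a f <= disagreements (toggle a x y) f + 2.
Proof.
move=> xy; rewrite -(sum_same_pair xy) /disagreements -big_split /=.
apply: leq_sum => u _; rewrite -big_split; apply: leq_sum => v _ /=.
by rewrite /toggle; case: (u == v); case: (a u v); case: same; case: same_pair.
Qed.

Lemma disagreements_toggle a x y f : symmetric a -> x != y ->
  a x y != same f x y -> disagreements a f = disagreements (toggle a x y) f + 2.
Proof.
move=> sym xy conflict; rewrite -(sum_same_pair xy) -big_split.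
apply: eq_bigr => u _ /=; rewrite -big_split; apply: eq_bigr => v _ /=.
rewrite /toggle; case: (boolP (same_pair x y u v)); last by rewrite addbF addn0.
have {}conflict : a x y (+) same f x y by rewrite -negb_eqb.
case/orP=> /andP[/eqP -> /eqP ->]; rewrite addbT addNb.
  by rewrite xy conflict.
by rewrite eq_sym xy sym [same f y x]eq_sym conflict.
Qed.

Definition P3 a x y z : bool := [&& a x y, a y z, ~~ a x z & x != z].

Definition find_P3_via a x y : option (V * V * V) :=
  last_some (fun z => if P3 a x y z then Some (x, y, z) else None) (enum V).

Definition find_P3_from a x : option (V * V * V) :=
  last_some (find_P3_via a x) (enum V).

Definition find_P3 a : option (V * V * V) :=
  last_some (find_P3_from a) (enum V).

Lemma find_P3_some a x y z : find_P3 a = Some (x, y, z) -> P3 a x y z.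
Proof.
move=> e; have [x' _ ex] := last_some_mem e; have [y' _ ey] := last_some_mem ex.
by have [z' _] := last_some_mem ey; case: ifP => // + [<- <- <-].
Qed.

Lemma find_P3_none a x y z : find_P3 a = None -> ~~ P3 a x y z.
Proof.
move=> /last_some_none/(_ (mem_enum _ x)) /last_some_none/(_ (mem_enum _ y)).
by move=> /last_some_none/(_ (mem_enum _ z)); case: ifP.
Qed.

Lemma P3_conflict a x y z f : P3 a x y z ->
  [|| a x y != same f x y, a y z != same f y z | a x z != same f x z].
Proof.
rewrite /same => /and4P[-> -> /negbTE -> _].
by case: (eqVneq (f x) (f y)) => //= ->; case: (f y == f z).
Qed.

Lemma P3_neq a x y z : simple_graph a -> P3 a x y z ->
  [/\ x != y, y != z & x != z].
Proof.
move=> [_ irr] /and4P[axy ayz _ xz]; split=> //.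
  by apply: contraTneq axy => ->; rewrite irr.
by apply: contraTneq ayz => ->; rewrite irr.
Qed.

Definition label (e : rel V) x : nat := enum_rank [set y | e x y].

Lemma same_label (e : rel V) : equivalence_rel e -> same (label e) =2 e.
Proof.
move=> eqv x y; have [ex exy] := (eqv x x x, eqv x y).
apply/eqP/idP => [/val_inj/enum_rank_inj/setP/(_ y)|e_xy].
  by rewrite !inE (eqv y y y) => ->.
congr (nat_of_ord (enum_rank _)); apply/setP => z; rewrite !inE.
by have [_ ->] := eqv x y z.
Qed.

Definition closed_neighbour a : rel V := fun x y => (x == y) || a x y.

Section P3free.
Variable a : rel V.
Hypothesis a_simple : simple_graph a.
Hypothesis a_P3free : find_P3 a = None.

Lemma equivalence_closed_neighbour : equivalence_rel (closed_neighbour a).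
Proof.
have [sym _] := a_simple; have Nsym : symmetric (closed_neighbour a).
  by move=> x y; rewrite /closed_neighbour eq_sym sym.
suff trans : transitive (closed_neighbour a).
  move=> x y z; split; first by rewrite /closed_neighbour eqxx.
  by move=> xy; apply/idP/idP; apply: trans; rewrite // Nsym.
move=> y x z; rewrite /closed_neighbour.
case: (eqVneq x y) => [->|_] //= axy;
  case: (eqVneq y z) => [<-|_] /= => [_|ayz].
  by rewrite axy orbT.
have := find_P3_none x y z a_P3free; rewrite /P3 axy ayz /= negb_and !negbK.
by case/orP=> ->; rewrite ?orbT.
Qed.

Lemma disagreements_label f :
  disagreements a f = disagreements (same (label (closed_neighbour a))) f.
Proof.
apply: eq_disagreements => // x y /negbTE xy.
by rewrite same_label ?/closed_neighbour ?xy //;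
  exact: equivalence_closed_neighbour.
Qed.

Definition degree_profile s : nat := #|[set x | #|a x|.+1 == s]|.

Lemma profile_label s :
  profile (label (closed_neighbour a)) s = degree_profile s.
Proof.
have [sym irr] := a_simple; apply: eq_card => x; rewrite !inE; congr (_ == s).
have -> : #|a x|.+1 = #|x |: [set y | a x y]|.
  rewrite cardsU1 inE irr add1n; congr _.+1.
  by apply: eq_card => y; rewrite inE.
apply: eq_card => y; rewrite !inE -[_ == _]/(same _ y x) same_label.
  by rewrite /closed_neighbour sym.
exact: equivalence_closed_neighbour.
Qed.

End P3free.
End Graphs.

(** * Runs driven by digit strings *)

Record move_state := MoveState {
  sizes : nat -> nat; part1 : nat; part2 : nat; cost : nat }.

Definition split_profile (N : nat -> nat) p q : nat -> nat :=
  fun s => N s + (p == s) * p + (q == s) * q - (p + q == s) * (p + q).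

Definition merge_profile (N : nat -> nat) p q : nat -> nat :=
  fun s => N s + (p + q == s) * (p + q) - (p == s) * p - (q == s) * q.

Definition can_split (N : nat -> nat) p q : bool := p + q <= N (p + q).

Definition can_merge (N : nat -> nat) p q : bool :=
  (p <= N p) && (q <= N q - (p == q) * p).

Section Moves.
Variable k : nat.

Definition step (st : move_state) (d : nat) : option move_state :=
  let: MoveState N p q c := st in
  match d with
  | 0 => if can_split N p q && (c + p * q <= k)
         then Some (MoveState (split_profile N p q) 1 1 (c + p * q)) else None
  | 1 => if can_merge N p q && (c + p * q <= k)
         then Some (MoveState (merge_profile N p q) 1 1 (c + p * q)) else None
  | 2 => Some (MoveState N p.+1 q c)
  | _ => Some (MoveState N p q.+1 c)
  end.

Definition steps (ds : seq nat) (st : option move_state) : option move_state :=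
  foldl (fun o d => obind (step^~ d) o) st ds.

Lemma steps_cat ds1 ds2 st : steps (ds1 ++ ds2) st = steps ds2 (steps ds1 st).
Proof. exact: foldl_cat. Qed.

Lemma steps_nseq2 j N p q c :
  steps (nseq j 2) (Some (MoveState N p q c)) = Some (MoveState N (p + j) q c).
Proof. by elim: j p => [|j IH] p; rewrite ?addn0 // [LHS]IH addSnnS. Qed.

Lemma steps_nseq3 j N p q c :
  steps (nseq j 3) (Some (MoveState N p q c)) = Some (MoveState N p (q + j) c).
Proof. by elim: j q => [|j IH] q; rewrite ?addn0 // [LHS]IH addSnnS. Qed.

Definition move_code op p q : seq nat := nseq p.-1 2 ++ nseq q.-1 3 ++ [:: op].

Lemma size_move_code op p q : 0 < p -> 0 < q ->
  size (move_code op p q) <= p * q.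
Proof. by rewrite !size_cat !size_nseq /=; nia. Qed.

Lemma all_move_code op p q : op < 4 -> all (fun d => d < 4) (move_code op p q).
Proof. by move=> op4; rewrite !all_cat !all_nseq /= op4 !orbT. Qed.

Lemma steps_move_code op p q N c : 0 < p -> 0 < q ->
  steps (move_code op p q) (Some (MoveState N 1 1 c)) =
  step (MoveState N p q c) op.
Proof.
move=> p0 q0; rewrite /move_code !steps_cat steps_nseq2 steps_nseq3.
by rewrite !add1n !prednK.
Qed.

Section Labellings.
Variable V : finType.
Implicit Types (a : rel V) (f g h : V -> nat) (N : nat -> nat).

Lemma split_profileE p q f h N : splits p q f h -> N =1 profile f ->
  split_profile N p q =1 profile h.
Proof.
by move=> fh Nf s; have := profile_splits s fh; rewrite /split_profile Nf; lia.
Qed.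

Lemma merge_profileE p q f h N : splits p q f h -> N =1 profile h ->
  merge_profile N p q =1 profile f.
Proof.
by move=> fh Nh s; have := profile_splits s fh; rewrite /merge_profile Nh; lia.
Qed.

Lemma splits_can_split p q f h N : 0 < p -> 0 < q ->
  splits p q f h -> N =1 profile f -> can_split N p q.
Proof.
move=> p0 q0 fh Nf; have := profile_splits (p + q) fh.
by rewrite /can_split Nf eqxx; lia.
Qed.

Lemma splits_can_merge p q f h N : 0 < p -> 0 < q ->
  splits p q f h -> N =1 profile h -> can_merge N p q.
Proof.
move=> p0 q0 fh Nh; have := profile_splits p fh; have := profile_splits q fh.
by rewrite /can_merge !Nh !eqxx eq_sym; case: (eqVneq p q) => [->|_]; lia.
Qed.

Definition attained a (st : move_state) : Prop :=
  [/\ 0 < part1 st, 0 < part2 st, cost st <= k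
    & exists2 f, sizes st =1 profile f & disagreements a f <= 2 * cost st].

Lemma attained_sizes_le a st s : attained a st -> sizes st s <= #|V|.
Proof. by move=> [_ _ _ [f -> _]]; exact: profile_le. Qed.

Lemma step_attained a st st' d : attained a st -> step st d = Some st' ->
  attained a st'.
Proof.
case: st => N p q c [/= p0 q0 ck [f Nf af]].
case: d => [|[|[|d]]] /=; try by case=> <-; split=> //; exists f.
  case: ifP => // /andP[can ck'] [<-].
  have [|h fh] := @exists_split _ p q f p0 q0.
    by rewrite -Nf; move: can; rewrite /can_split; lia.
  split=> //; exists h; first exact: split_profileE fh Nf.
  by have [_] := disagreements_splits a fh; rewrite /=; lia.
case: ifP => // /andP[/andP[pN qN] ck'] [<-].
have [||h hf] := @exists_merge _ p q f p0 q0; first by rewrite -Nf.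
  by rewrite -Nf.
split=> //; exists h; first exact: merge_profileE hf Nf.
by have [+ _] := disagreements_splits a hf; rewrite /=; lia.
Qed.

Lemma steps_attained a ds st st' : attained a st ->
  steps ds (Some st) = Some st' -> attained a st'.
Proof.
elim/last_ind: ds st' => [|ds d IH] st' ast; first by case=> <-.
rewrite -cats1 steps_cat; case e: (steps ds _) => [st1|] //=.
exact: step_attained (IH _ ast e).
Qed.

Lemma part_sum_steps a ds st st' : attained a st ->
  steps ds (Some st) = Some st' ->
  part1 st' + part2 st' <= part1 st + part2 st + size ds.
Proof.
elim/last_ind: ds st' => [|ds d IH] st' ast; first by case=> <-; rewrite addn0.
rewrite -cats1 steps_cat size_cat /= addn1 addnS.
case e: (steps ds _) => [st1|] //=; have {IH} := IH _ ast e.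
have [] := steps_attained ast e; case: {e} st1 => N p q c /= p0 q0 _ _ pq_le.
by case: d => [|[|[|d]]] /=; try case: ifP => // _; case=> <- /=; lia.
Qed.

Lemma step_towards p q f h N c : 0 < p -> 0 < q -> c + p * q <= k ->
  splits p q f h \/ splits p q h f -> N =1 profile f ->
  exists op N', [/\ op < 4, N' =1 profile h &
    step (MoveState N p q c) op = Some (MoveState N' 1 1 (c + p * q))].
Proof.
move=> p0 q0 ck mv Nf; case: mv => [fh|hf].
  exists 0, (split_profile N p q); split=> //.
    exact: split_profileE fh Nf.
  by rewrite /= ck (splits_can_split p0 q0 fh Nf).
exists 1, (merge_profile N p q); split=> //; first exact: merge_profileE hf Nf.
by rewrite /= ck (splits_can_merge p0 q0 hf Nf).
Qed.

Lemma steps_towards f g m N c : disagreements (same g) f <= 2 * m ->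
  c + m <= k -> N =1 profile f ->
  exists ds N' c', [/\ size ds <= m, all (fun d => d < 4) ds, N' =1 profile g &
    steps ds (Some (MoveState N 1 1 c)) = Some (MoveState N' 1 1 c')].
Proof.
elim/ltn_ind: m f N c => m IH f N c dm ck Nf.
have [/disagreements_eq0 gf|/move_towards] := posnP (disagreements (same g) f).
  by exists [::], N, c; split=> // s; rewrite Nf (eq_profile gf).
move=> [p [q [h [p0 q0 mv dfh]]]]; have pq0 : 0 < p * q by rewrite muln_gt0 p0.
have [|op [N1 [op4 N1h step1]]] := @step_towards p q f h N c p0 q0 _ mv Nf.
  by lia.
have [||| ds [N' [c' [ds_size ds4 N'g steps_ds]]]] :=
  IH (m - p * q) _ h N1 (c + p * q) _ _ N1h; try by lia.
exists (move_code op p q ++ ds), N', c'; split=> //.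
- by rewrite size_cat; have := size_move_code op p0 q0; lia.
- by rewrite all_cat all_move_code.
- by rewrite steps_cat steps_move_code // step1.
Qed.

End Labellings.
End Moves.

Section Digits.
Variables (V : finType) (k eta : nat).
Implicit Types (a : rel V) (f : V -> nat) (N : nat -> nat).

Definition P3_pair (t : V * V * V) (d : nat) : V * V :=
  let: (x, y, z) := t in
  match d with 0 => (x, y) | 1 => (y, z) | _ => (x, z) end.

Definition toggle_P3 a t d : rel V := toggle a (P3_pair t d).1 (P3_pair t d).2.

Lemma P3_pair_neq a x y z d : simple_graph a -> P3 a x y z ->
  (P3_pair (x, y, z) d).1 != (P3_pair (x, y, z) d).2.
Proof. by move=> sa /(P3_neq sa)[]; case: d => [|[|d]]. Qed.

Fixpoint repair (ds : seq nat) a : rel V * seq nat :=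
  match find_P3 a, ds with
  | Some t, d :: ds' => repair ds' (toggle_P3 a t d)
  | _, _ => (a, ds)
  end.

Definition balanced_profile N : bool :=
  all2rel (fun s t => [|| N s == 0, N t == 0 | s - t <= eta]) (iota 1 #|V|).

Definition balanced_labelling f : Prop :=
  forall x y, block_size f x - block_size f y <= eta.

Definition initial a c : move_state := MoveState (degree_profile a) 1 1 c.

Definition accepts_digits (ds : seq nat) a : bool :=
  let: (a', rest) := repair ds a in
  (find_P3 a' == None) &&
  (if steps k rest (Some (initial a' (size ds - size rest))) is Some st
   then balanced_profile (sizes st) else false).

Lemma simple_toggle_P3 a x y z d : simple_graph a -> P3 a x y z ->
  simple_graph (toggle_P3 a (x, y, z) d).
Proof.
by move=> sa p3; apply: simple_toggle => //; exact: P3_pair_neq sa p3.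
Qed.

Lemma repair_sound ds a : simple_graph a ->
  let: (a', rest) := repair ds a in
  [/\ simple_graph a', size rest <= size ds &
   forall f,
     disagreements a f <= disagreements a' f + 2 * (size ds - size rest)].
Proof.
elim: ds a => [|d ds IH] a sa /=.
  by case: find_P3 => [t|]; split=> // f; rewrite leq_addr.
case e: (find_P3 a) => [[[x y] z]|]; last by split=> // f; rewrite leq_addr.
have p3 := find_P3_some e.
case: repair (IH _ (simple_toggle_P3 d sa p3)) => a' rest [sa' le_rest le_f].
split=> [//||f]; first exact: leqW.
apply: leq_trans (_ : _ <= disagreements (toggle_P3 a (x, y, z) d) f + 2) _.
  exact/disagreements_toggle_le/(P3_pair_neq d sa p3).
by have := le_f f; lia.
Qed.

Lemma P3_digit a x y z f : simple_graph a -> P3 a x y z -> exists2 d, d < 4 &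
  disagreements a f = disagreements (toggle_P3 a (x, y, z) d) f + 2.
Proof.
move=> sa p3; have [xy yz xz] := P3_neq sa p3; have [sym _] := sa.
case/or3P: (P3_conflict f p3) => conflict.
- by exists 0 => //; exact: disagreements_toggle.
- by exists 1 => //; exact: disagreements_toggle.
- by exists 2 => //; exact: disagreements_toggle.
Qed.

Lemma repair_complete f m a : simple_graph a -> disagreements a f <= 2 * m ->
  exists ds a', [/\ size ds <= m, all (fun d => d < 4) ds,
    simple_graph a' /\ find_P3 a' = None,
    disagreements a f = disagreements a' f + 2 * size ds &
    forall rest, repair (ds ++ rest) a = (a', rest)].
Proof.
elim: m a => [|m IH] a sa af; case e: (find_P3 a) => [[[x y] z]|];
  try by exists [::], a; split=> //=; [lia | case=> [|d rest] /=; rewrite e].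
all: have p3 := find_P3_some e; have [d d4 ed] := P3_digit f sa p3.
  by lia.
have [|ds [a' [ds_size ds4 a'P3 e_f e_repair]]] :=
  IH _ (simple_toggle_P3 d sa p3).
  by lia.
exists (d :: ds), a'; split=> //=; first by rewrite d4.
  by lia.
by move=> rest; rewrite e.
Qed.

Lemma balanced_profileP f N : N =1 profile f ->
  reflect (balanced_labelling f) (balanced_profile N).
Proof.
move=> Nf; apply: (iffP allrelP) => [bal x y|bal s t _ _].
  have sz z : block_size f z \in iota 1 #|V|.
    by rewrite mem_iota block_size_gt0 add1n ltnS block_size_le.
  have N0 z : (N (block_size f z) == 0) = false.
    by apply/negbTE; rewrite -lt0n Nf; apply/profile_gt0P; exists z.
  by have := bal _ _ (sz x) (sz y); rewrite !N0.
rewrite !Nf; have [//|/profile_gt0P[x <-]] := posnP (profile f s).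
by have [//|/profile_gt0P[y <-]] := posnP (profile f t); rewrite bal !orbT.
Qed.

Lemma attained_initial ds a a' rest : simple_graph a -> size ds <= k ->
  repair ds a = (a', rest) -> find_P3 a' = None ->
  attained k a (initial a' (size ds - size rest)).
Proof.
move=> sa ds_k rep nP3.
have := repair_sound ds sa; rewrite rep => -[sa' _ le_f].
split=> //=; first exact: leq_trans (leq_subr _ _) ds_k.
exists (label (closed_neighbour a')) => [s|]; first by rewrite profile_label.
by apply: leq_trans (le_f _) _;
  rewrite disagreements_label // disagreements_same.
Qed.

Lemma accepts_digits_sound ds a : simple_graph a -> size ds = k ->
  accepts_digits ds a ->
  exists2 f, disagreements a f <= 2 * k & balanced_labelling f.
Proof.
move=> sa ds_size; rewrite /accepts_digits.
case rep: (repair ds a) => [a' rest]; case/andP=> /eqP nP3.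
case e: steps => [st|] // bal.
have [|_ _ ck [f sf af]] := steps_attained (attained_initial sa _ rep nP3) e.
  by rewrite ds_size.
exists f; last exact/(balanced_profileP sf).
by apply: leq_trans af _; rewrite leq_mul2l ck orbT.
Qed.

Lemma accepts_digits_complete f a : simple_graph a ->
  disagreements a f <= 2 * k -> balanced_labelling f ->
  exists ds, [/\ size ds = k, all (fun d => d < 4) ds & accepts_digits ds a].
Proof.
move=> sa af bal.
have [ds1 [a' [ds1_size ds1_4 [sa' nP3] e_f repair1]]] := repair_complete sa af.
have [|||ds2 [N [c [ds2_size ds2_4 Nf steps2]]]] :=
  @steps_towards k _ (label (closed_neighbour a')) f (k - size ds1)
    (degree_profile a') (size ds1).
- by rewrite disagreements_sameC -disagreements_label //; lia.
- by lia.
- by move=> s; rewrite profile_label.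
pose pad := nseq (k - size ds1 - size ds2) 2.
exists (ds1 ++ ds2 ++ pad); split.
- by rewrite !size_cat size_nseq; lia.
- by rewrite !all_cat ds1_4 ds2_4 all_nseq orbT.
rewrite /accepts_digits repair1 nP3 eqxx size_cat addnK steps_cat.
by rewrite steps2 steps_nseq2; exact/(balanced_profileP Nf).
Qed.

Lemma accepts_digits_iff a : simple_graph a ->
  (exists ds,
    [/\ size ds = k, all (fun d => d < 4) ds & accepts_digits ds a]) <->
  exists2 f, disagreements a f <= 2 * k & balanced_labelling f.
Proof.
move=> sa; split=> [[ds [ds_size _]]|[f]]; first exact: accepts_digits_sound.
exact: accepts_digits_complete.
Qed.

End Digits.

(** * Cluster editings as labellings *)

Section Editing.
Variable V : finType.
Implicit Types (E F : {set {set V}}) (f : V -> nat) (x y : V).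

Lemma eq_set2 x y u v : x != y ->
  ([set u; v] == [set x; y]) = same_pair x y u v.
Proof.
move=> xy; apply/eqP/idP => [uv_xy|]; last first.
  by case/orP=> /andP[/eqP -> /eqP ->] //; rewrite setUC.
have uv : u != v.
  have := congr1 (fun A : {set V} => #|A|) uv_xy.
  by rewrite !cards2 xy; case: (u != v).
move: (set21 u v) (set22 u v) uv; rewrite uv_xy !inE /same_pair.
by case/orP=> /eqP ->; case/orP=> /eqP ->; rewrite ?eqxx ?orbT.
Qed.

Lemma sum_pairs F : F \subset pairs V ->
  \sum_x \sum_y ([set x; y] \in F) = 2 * #|F|.
Proof.
move=> /subsetP sF.
rewrite -sum1_card big_distrr /=.
have -> : \sum_(A in F) 2 * 1 = \sum_(A in F) \sum_x \sum_y ([set x; y] == A).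
  apply: eq_bigr => A /sF; rewrite inE => /cards2P[x [y [xy ->]]].
  rewrite muln1 -(sum_same_pair xy); apply: eq_bigr => u _ /=.
  by apply: eq_bigr => v _; rewrite eq_set2.
rewrite [RHS]exchange_big; apply: eq_bigr => x _; rewrite [RHS]exchange_big /=.
apply: eq_bigr => y _; rewrite big_mkcond (bigD1 [set x; y]) //= eqxx.
rewrite big1 ?addn0 => [|A /negbTE]; first by case: ifP.
by rewrite eq_sym => ->; case: ifP.
Qed.

Lemma simple_adj E : E \subset pairs V -> simple_graph (adj E).
Proof.
move=> /subsetP sE; split=> [x y|x]; rewrite /adj /= 1?setUC //.
by apply/negP => /sE; rewrite inE setUid cards1.
Qed.

Lemma adj_symdiff E F x y :
  adj (symdiff E F) x y = adj E x y (+) ([set x; y] \in F).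
Proof. by rewrite /adj /= !inE; case: (_ \in E); case: (_ \in F). Qed.

Definition labelled_by E f : Prop := forall x y, x != y ->
  adj E x y = same f x y.

Lemma connect_labelled E f : labelled_by E f -> connect (adj E) =2 same f.
Proof.
move=> Ef x y; apply/idP/idP => [/connectP[p]|fxy]; last first.
  by have [->|xy] := eqVneq x y; [exact: connect0 | apply/connect1; rewrite Ef].
elim: p x => [|z p IH] x /=; first by move=> _ ->; exact: eqxx.
case/andP=> xz /IH{}IH /IH; rewrite /same => /eqP <-.
by have [->|ne_xz] := eqVneq x z; rewrite ?eqxx // -[_ == _]/(same f x z) -Ef.
Qed.

Lemma cluster_graphP E : symmetric (adj E) ->
  cluster_graph E <-> exists f, labelled_by E f.
Proof.
move=> sym; split=> [clE|[f Ef] _ /imsetP[z _ ->] x y]; last first.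
  rewrite !inE !(connect_labelled Ef) => /eqP zx /eqP zy xy.
  by rewrite Ef // /same -zx zy.
have eqv : equivalence_rel (connect (adj E)).
  move=> x y z; split=> [|xy]; first exact: connect0.
  exact: same_connect (sym_connect_sym sym) _ _ xy z.
exists (label (connect (adj E))) => x y xy; rewrite same_label //.
apply/idP/idP; first exact: connect1.
move=> c_xy; apply: (clE (component E x)); rewrite ?inE //.
by apply/imsetP; exists x.
Qed.

Lemma balanced_labelled E f eta : labelled_by E f ->
  balanced eta E <-> balanced_labelling eta f.
Proof.
move=> Ef; have sz x : block_size f x = #|component E x|.
  by apply: eq_card => y; rewrite !inE (connect_labelled Ef) /same eq_sym.
split=> [bal x y|bal _ _ /imsetP[x _ ->] /imsetP[y _ ->]].
  have := bal (component E x) (component E y) (imset_f _ isT) (imset_f _ isT).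
  by rewrite -!sz; lia.
by rewrite -!sz; have := bal x y; have := bal y x; lia.
Qed.

Lemma disagreements_labelled E F f : F \subset pairs V ->
  labelled_by (symdiff E F) f -> disagreements (adj E) f = 2 * #|F|.
Proof.
move=> /subsetP sF EFf; rewrite -sum_pairs; last exact/subsetP.
apply: eq_bigr => x _; apply: eq_bigr => y _.
have [<-|xy] := eqVneq x y; last by rewrite -EFf // adj_symdiff addKb.
by apply/esym/eqP; rewrite eqb0; apply/negP => /sF; rewrite inE setUid cards1.
Qed.

Lemma exists_editing_set E f : E \subset pairs V ->
  exists2 F : {set {set V}}, F \subset pairs V & labelled_by (symdiff E F) f.
Proof.
move=> sE; have [sym _] := simple_adj sE.
pose wrong (p : V * V) := (p.1 != p.2) && (adj E p.1 p.2 (+) same f p.1 p.2).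
exists [set [set p.1; p.2] | p in wrong].
  by apply/subsetP => _ /imsetP[p /andP[ne _] ->]; rewrite inE cards2 ne.
move=> x y xy; rewrite adj_symdiff.
suff -> : ([set x; y] \in [set [set p.1; p.2] | p in wrong]) =
    adj E x y (+) same f x y by rewrite addKb.
apply/imsetP/idP => [[[u v] /andP[/= _ uv] /eqP]|xy_wrong].
  rewrite eq_sym eq_set2 //.
  case/orP=> /andP[/eqP ux /eqP vy]; rewrite ux vy in uv => //.
  by rewrite sym [same f x y]eq_sym.
by exists (x, y); rewrite //= unfold_in /wrong /= xy.
Qed.

Lemma balanced_cluster_editingP E k eta : E \subset pairs V ->
  balanced_cluster_editing E k eta <->
  exists2 f, disagreements (adj E) f <= 2 * k & balanced_labelling eta f.
Proof.
move=> sE; have [sym _] := simple_adj sE.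
have sym' F : symmetric (adj (symdiff E F)).
  by move=> x y; rewrite /adj /= setUC.
split=> [[F [sF Fk /(cluster_graphP (sym' F))[f EFf] bal]]|[f dis bal]].
  exists f; last exact/(balanced_labelled _ EFf).
  by rewrite (disagreements_labelled sF EFf) leq_mul2l.
have [F sF EFf] := exists_editing_set f sE; exists F; split=> //.
- by move: dis; rewrite (disagreements_labelled sF EFf) leq_mul2l.
- by apply/cluster_graphP => //; exists f.
- exact/(balanced_labelled _ EFf).
Qed.

End Editing.

(** * Digits of natural numbers *)

Section BaseDigits.
Variable b : nat.
Hypothesis b_gt0 : 0 < b.

Definition digit v r : nat := (v %/ b ^ r) %% b.

Definition digits k v : seq nat := mkseq (digit v) k.

Lemma digits_lt k v : all (fun d => d < b) (digits k v).
Proof. by apply/allP => _ /mapP[r _ ->]; rewrite ltn_mod. Qed.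

Lemma digits_surj k ds : size ds = k -> all (fun d => d < b) ds ->
  exists2 v, v < b ^ k & digits k v = ds.
Proof.
elim: ds k => [|d ds IH] [|k] //=; first by exists 0.
move=> [ds_size] /andP[d_lt ds_lt]; have [v v_lt v_ds] := IH k ds_size ds_lt.
exists (v * b + d).
  rewrite expnSr; apply: (@leq_trans (v.+1 * b)); first by rewrite mulSn; lia.
  by rewrite leq_mul2r v_lt orbT.
rewrite /digits /mkseq /= /digit expn0 divn1 modnMDl modn_small //.
congr (_ :: _).
rewrite -[1]addn0 iotaDl -map_comp -v_ds; apply: eq_map => r /=.
by rewrite /digit add1n expnS divnMA divnMDl // [d %/ b]divn_small // addn0.
Qed.

Lemma digit_carry v r : b ^ r %| v.+1 ->
  digit v.+1 r = (if digit v r == b.-1 then 0 else (digit v r).+1) /\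
  (b ^ r.+1 %| v.+1) = (digit v r == b.-1).
Proof.
have br_gt0 : 0 < b ^ r by rewrite expn_gt0 b_gt0.
move=> /dvdnP[[|w] e] //.
have dig_v : digit v r = w %% b.
  have -> : v = w * b ^ r + (b ^ r).-1 by lia.
  by rewrite /digit divnMDl // divn_small ?addn0 // prednK.
have dvd_w : (b %| w.+1) = (w %% b == b.-1).
  apply/idP/eqP => [/dvdnP[q qb]|wb].
    have -> : w = q.-1 * b + b.-1 by case: q qb => [|q]; lia.
    by rewrite modnMDl modn_small // prednK.
  by rewrite (divn_eq w b) wb -addnS prednK // dvdn_addl ?dvdn_mull.
by rewrite {1}/digit dig_v e mulnK // modnS expnS dvdn_pmul2r // dvd_w.
Qed.

Lemma digit_no_carry v r : ~~ (b ^ r %| v.+1) -> digit v.+1 r = digit v r.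
Proof.
have br_gt0 : 0 < b ^ r by rewrite expn_gt0 b_gt0.
rewrite /dvdn -lt0n /digit => h; congr (_ %% b).
have lt := ltn_pmod v.+1 br_gt0.
have v_eq : v = v.+1 %/ b ^ r * b ^ r + (v.+1 %% b ^ r).-1.
  by have := divn_eq v.+1 (b ^ r); lia.
by rewrite [in RHS]v_eq divnMDl // [X in _ = _ + X]divn_small ?addn0 //; lia.
Qed.

End BaseDigits.

(** * The algorithm *)

Coercion EConst : nat >-> expr.
Coercion EVar : var >-> expr.

Notation "c1 ;; c2" := (CSeq c1 c2) (at level 60, right associativity).
Notation "x ::= e" := (CSet x e) (at level 50).

Definition EGet1 a e : expr := EGet a 0 e.
Definition CPut1 a e e' : com := CPut a 0 e e'.
Definition CWhen e c : com := CIf e c CSkip.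
Definition CUnless e c : com := CIf e CSkip c.
Definition CIfLe e1 e2 c1 c2 : com := CIf (ESub e1 e2) c2 c1.
Definition CIncr x : com := x ::= EAdd x 1.

(* Variable [i] is stored in cell [i] of the machine, so that the first three
   variables are the numbers [n], [k], [eta] of the encoding. *)
Definition v_n := Var 0.
Definition v_k := Var 1.
Definition v_eta := Var 2.
Definition v_answer := Var 3.
Definition v_running := Var 4.
Definition v_i := Var 5.
Definition v_j := Var 6.
Definition v_l := Var 7.
Definition v_found := Var 8.
Definition v_path1 := Var 9.
Definition v_path2 := Var 10.
Definition v_path3 := Var 11.
Definition v_used := Var 12.
Definition v_digit := Var 13.
Definition v_part1 := Var 14.
Definition v_part2 := Var 15.
Definition v_cost := Var 16.
Definition v_failed := Var 17.
Definition v_round := Var 18.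
Definition v_carry := Var 19.
Definition v_end1 := Var 20.
Definition v_end2 := Var 21.
Definition v_size := Var 22.
Definition v_cell := Var 23.

Definition a_input := Array 0.
Definition a_matrix := Array 1.
Definition a_digits := Array 2.
Definition a_profile := Array 3.
Definition a_bits := Array 4.

Definition CheckP3 : com :=
  CWhen (EGet a_matrix v_i v_j) (CWhen (EGet a_matrix v_j v_l)
    (CUnless (EGet a_matrix v_i v_l)
      (CWhen (EAdd (ESub v_i v_l) (ESub v_l v_i))
        (v_found ::= 1;; v_path1 ::= v_i;; v_path2 ::= v_j;;
          v_path3 ::= v_l)))).

Definition FindP3 : com :=
  v_found ::= 0;; CFor v_i v_n (CFor v_j v_n (CFor v_l v_n CheckP3)).

Definition ChooseEnds : com :=
  CIfLe v_digit 0 (v_end1 ::= v_path1;; v_end2 ::= v_path2)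
    (CIfLe v_digit 1 (v_end1 ::= v_path2;; v_end2 ::= v_path3)
                     (v_end1 ::= v_path1;; v_end2 ::= v_path3)).

Definition ToggleEnds : com :=
  CPut a_matrix v_end1 v_end2 (ESub 1 (EGet a_matrix v_end1 v_end2));;
  CPut a_matrix v_end2 v_end1 (EGet a_matrix v_end1 v_end2).

Definition ToggleP3 : com :=
  v_digit ::= EGet1 a_digits v_used;; ChooseEnds;; ToggleEnds;; CIncr v_used.

Definition Repair : com :=
  v_used ::= 0;; CFor v_round v_k (FindP3;; CWhen v_found ToggleP3).

Definition CopyRow : com :=
  CFor v_j v_n (CPut a_matrix v_i v_j (EGet a_input v_i v_j)).

Definition CopyInput : com := CFor v_i v_n CopyRow.

Definition Degree : com :=
  v_size ::= 1;; CFor v_j v_n (CWhen (EGet a_matrix v_i v_j) (CIncr v_size)).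

Definition InitProfile : com :=
  CFor v_size ECap (CPut1 a_profile (EAdd v_size 1) 0);;
  CFor v_i v_n
    (Degree;; CPut1 a_profile v_size (EAdd (EGet1 a_profile v_size) 1)).

Definition Take x : com :=
  CIfLe x (EGet1 a_profile x) CSkip (v_failed ::= 1);;
  CPut1 a_profile x (ESub (EGet1 a_profile x) x).

Definition Give x : com := CPut1 a_profile x (EAdd (EGet1 a_profile x) x).

Definition Pay : com :=
  CFor v_i v_part1 (CFor v_j v_part2 (CIncr v_cost));;
  CIfLe v_cost v_k CSkip (v_failed ::= 1).

Definition ResetParts : com := v_part1 ::= 1;; v_part2 ::= 1.

Definition Settle : com := Pay;; ResetParts.

Definition Split : com :=
  v_size ::= EAdd v_part1 v_part2;;
  Take v_size;; Give v_part1;; Give v_part2;; Settle.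

Definition Merge : com :=
  v_size ::= EAdd v_part1 v_part2;;
  Take v_part1;; Take v_part2;; Give v_size;; Settle.

Definition Step : com :=
  v_digit ::= EGet1 a_digits (EAdd v_used v_round);;
  CIfLe v_digit 0 Split (CIfLe v_digit 1 Merge
    (CIfLe v_digit 2 (CIncr v_part1) (CIncr v_part2))).

Definition Moves : com :=
  ResetParts;; v_cost ::= v_used;; v_failed ::= 0;;
  CFor v_round (ESub v_k v_used) (CUnless v_failed Step).

Definition CheckBalance : com :=
  CFor v_i v_n (CFor v_j v_n
    (CWhen (EGet1 a_profile (EAdd v_i 1)) (CWhen (EGet1 a_profile (EAdd v_j 1))
      (CIfLe (ESub v_i v_j) v_eta CSkip (v_failed ::= 1))))).

Definition Verdict : com :=
  FindP3;; CheckBalance;; CUnless v_found (CUnless v_failed (v_answer ::= 1)).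

Definition CarryDigit : com :=
  CWhen v_carry
    (CIfLe 3 (EGet1 a_digits v_round)
      (CPut1 a_digits v_round 0)
      (CPut1 a_digits v_round (EAdd (EGet1 a_digits v_round) 1);;
        v_carry ::= 0)).

Definition NextDigits : com :=
  v_carry ::= 1;; CFor v_round v_k CarryDigit;; CWhen v_carry (v_running ::= 0).

Definition TryDigits : com :=
  CopyInput;; Repair;; InitProfile;; Moves;; Verdict.

Definition Body : com := TryDigits;; NextDigits.

Section Commands.
Variables (W cap : nat) (inp : nat -> nat).
Notation eval := (eval W cap inp).
Notation run := (run W cap inp).

Lemma run_CWhen e c s :
  run (CWhen e c) s = if eval s e == 0 then s else run c s.
Proof. by []. Qed.

Lemma run_CUnless e c s :
  run (CUnless e c) s = if eval s e == 0 then run c s else s.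
Proof. by []. Qed.

Lemma run_CIfLe e1 e2 c1 c2 s :
  run (CIfLe e1 e2 c1 c2) s =
  if eval s e1 <= eval s e2 then run c1 s else run c2 s.
Proof. by rewrite [LHS]run_CIf /= subn_eq0. Qed.

Lemma vget_CIncr s x : vget s x < cap ->
  vget (run (CIncr x) s) x = (vget s x).+1.
Proof. by rewrite /= eqxx addn1 => /minn_idPl. Qed.

Lemma eval_EGet1 s a (x : var) : vget s x <= cap ->
  eval s (EGet1 a x) = aget s a 0 (vget s x).
Proof. by move=> /= /minn_idPl ->; rewrite min0n. Qed.

Lemma aget_CPut1 s a (x : var) e j : vget s x <= cap ->
  aget (run (CPut1 a x e) s) a 0 j =
  if j == vget s x then eval s e else aget s a 0 j.
Proof. by move=> /= /minn_idPl ->; rewrite min0n eqxx. Qed.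

End Commands.

Lemma minn_ord n m (i : 'I_n) : n <= m -> minn i m = i.
Proof. by have := ltn_ord i; lia. Qed.

Section GraphCommands.
Variables (W cap : nat) (inp : nat -> nat) (n : nat).
Hypothesis n_cap : n < cap.
Notation eval := (eval W cap inp).
Notation run := (run W cap inp).
Implicit Types (s : store) (a : rel 'I_n) (i j l u v : 'I_n).

Let minn_ord_cap i : minn i cap = i. Proof. exact: minn_ord (ltnW n_cap). Qed.

Definition holds_graph (b : array) s a : Prop :=
  forall i j, aget s b i j = a i j.

Definition holds_P3 s (r : option ('I_n * 'I_n * 'I_n)) : Prop :=
  if r is Some (x, y, z) then
    [/\ vget s v_found = 1, vget s v_path1 = x, vget s v_path2 = y
      & vget s v_path3 = z]
  else vget s v_found = 0.

Lemma run_CheckP3 s a r i j l :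
  vget s v_i = i -> vget s v_j = j -> vget s v_l = l ->
  holds_graph a_matrix s a -> holds_P3 s r ->
  holds_P3 (run CheckP3 s)
    (oapp Some r (if P3 a i j l then Some (i, j, l) else None)).
Proof.
move=> si sj sl ma Pr; rewrite /CheckP3 /P3 !run_CWhen run_CUnless run_CWhen.
rewrite /= si sj sl !minn_ord_cap !ma !eqb0.
case: (a i j) => //=; case: (a j l) => //=; case: (a i l) => //=.
have -> : (minn (i - l + (l - i)) cap == 0) = (i == l).
  by have := ltn_ord i; have := ltn_ord l; rewrite -val_eqE /=; lia.
by case: (i == l); rewrite //= si sj sl.
Qed.

Lemma run_CFor_last_some x c s r (F : 'I_n -> option ('I_n * 'I_n * 'I_n)) :
  vget s v_n = n -> holds_P3 s r ->
  (forall i s' r', frame (CFor x v_n c) s s' -> holds_P3 s' r' ->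
     holds_P3 (run c (vset s' x i)) (oapp Some r' (F i))) ->
  holds_P3 (run (CFor x v_n c) s) (oapp Some r (last_some F (enum 'I_n))).
Proof.
move=> sn Pr Pc.
apply: (run_CFor_enum (I := fun p s =>
  holds_P3 s (oapp Some r (last_some F p)))) => //.
  exact: ltnW.
move=> p i s' _ fr Pp; rewrite last_some_rcons.
have -> : oapp Some r (oapp Some (last_some F p) (F i)) =
    oapp Some (oapp Some r (last_some F p)) (F i) by case: (F i).
exact: Pc.
Qed.

Lemma run_FindP3 s a : vget s v_n = n -> holds_graph a_matrix s a ->
  holds_P3 (run FindP3 s) (find_P3 a).
Proof.
move=> sn ma; rewrite /FindP3 run_CSeq; set s0 := run _ s.
rewrite (_ : find_P3 a = oapp Some None (find_P3 a)); last by case: find_P3.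
apply: run_CFor_last_some => // i s1 r1 fr1 s1r.
apply: run_CFor_last_some => // [|j s2 r2 fr2 s2r].
  by rewrite /= (frame_var fr1).
apply: run_CFor_last_some => // [|l s3 r3 fr3 s3r].
  by rewrite /= (frame_var fr2) //= (frame_var fr1).
apply: run_CheckP3 => //=.
- by rewrite (frame_var fr3) //= (frame_var fr2).
- by rewrite (frame_var fr3).
- move=> u v; rewrite /= (frame_array fr3) //= (frame_array fr2) //=.
  by rewrite (frame_array fr1) //; exact: ma.
Qed.

Lemma run_ToggleEnds s a (x y : 'I_n) :
  vget s v_end1 = x -> vget s v_end2 = y -> x != y -> symmetric a ->
  holds_graph a_matrix s a ->
  holds_graph a_matrix (run ToggleEnds s) (toggle a x y).
Proof.
move=> sx sy xy sym ma u v; rewrite /= sx sy !minn_ord_cap !eqxx /= ma !val_eqE.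
rewrite /toggle /same_pair; case: (eqVneq u y) => [->|uy] /=.
  case: (eqVneq v x) => [->|vx] /=.
    by rewrite orbT addbT [a y x]sym; case: (a x y).
  by rewrite [y == x]eq_sym (negbTE xy) /= ma addbF.
rewrite orbF; case: (eqVneq u x) => [->|ux] /=; last by rewrite ma addbF.
case: (eqVneq v y) => [->|vy] /=; last by rewrite ma addbF.
by rewrite addbT; case: (a x y).
Qed.

Lemma run_ChooseEnds s t d : vget s v_digit = d -> holds_P3 s (Some t) ->
  run ChooseEnds s =
  vset (vset s v_end1 (P3_pair t d).1) v_end2 (P3_pair t d).2.
Proof.
case: t => [[x y] z] sd [_ s1 s2 s3]; rewrite /ChooseEnds !run_CIfLe /= sd.
by case: d sd => [|[|d]] _ /=; rewrite ?s1 ?s2 ?s3.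
Qed.

Lemma run_ToggleP3 s a t d : vget s v_used < cap ->
  aget s a_digits 0 (vget s v_used) = d -> simple_graph a ->
  holds_graph a_matrix s a -> find_P3 a = Some t -> holds_P3 s (Some t) ->
  holds_graph a_matrix (run ToggleP3 s) (toggle_P3 a t d) /\
  vget (run ToggleP3 s) v_used = (vget s v_used).+1.
Proof.
case: t => [[x y] z] used_cap sd sa ma /find_P3_some p3 st.
rewrite /ToggleP3 run_CSeq; set s1 := run _ s.
have s1d : vget s1 v_digit = d by rewrite /= min0n (minn_idPl (ltnW used_cap)).
rewrite run_CSeq (run_ChooseEnds (t := (x, y, z)) s1d) // run_CSeq; split.
  apply: run_ToggleEnds; rewrite ?(proj1 sa) //; last exact: (proj1 sa).
  exact: P3_pair_neq sa p3.
by rewrite vget_CIncr.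
Qed.

Lemma run_CopyRow s a i : vget s v_n = n -> vget s v_i = i ->
  (forall j, aget s a_input i j = a i j) ->
  (forall j, aget (run CopyRow s) a_matrix i j = a i j) /\
  (forall u j, u != i ->
     aget (run CopyRow s) a_matrix u j = aget s a_matrix u j).
Proof.
move=> sn si ia; have n_le_cap := ltnW n_cap.
have [copied others] :
    (forall j, j \in enum 'I_n -> aget (run CopyRow s) a_matrix i j = a i j) /\
    (forall u j, u != i ->
       aget (run CopyRow s) a_matrix u j = aget s a_matrix u j).
  apply: (run_CFor_enum (I := fun q s' =>
    (forall j, j \in q -> aget s' a_matrix i j = a i j) /\
    (forall u j, u != i -> aget s' a_matrix u j = aget s a_matrix u j))) => //.
  move=> q j s1 _ fr [row_q others].
  have s1i : vget s1 v_i = i by rewrite (frame_var fr).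
  have s1a : aget s1 a_input i j = a i j by rewrite (frame_array fr).
  split=> [v|u v ui] /=; rewrite s1i !minn_ord_cap s1a !val_eqE.
    rewrite eqxx mem_rcons inE /=.
    by case: (eqVneq v j) => [->|_] //; exact: row_q.
  by rewrite (negbTE ui) /=; exact: others.
by split=> // j; apply: copied; rewrite mem_enum.
Qed.

Lemma run_CopyInput s a : vget s v_n = n -> holds_graph a_input s a ->
  holds_graph a_matrix (run CopyInput s) a.
Proof.
move=> sn ia; have n_le_cap := ltnW n_cap.
suff copied : forall i j, i \in enum 'I_n ->
    aget (run CopyInput s) a_matrix i j = a i j.
  by move=> i j; apply: copied; rewrite mem_enum.
apply: (run_CFor_enum (I := fun p s =>
  forall i j, i \in p -> aget s a_matrix i j = a i j)) => //.
move=> p i s1 _ fr IHp.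
have [|||row_i others] := @run_CopyRow (vset s1 v_i i) a i.
- by rewrite /= (frame_var fr).
- by [].
- by move=> j; rewrite /= (frame_array fr).
move=> u v; rewrite mem_rcons inE; have [->|ui] /= := eqVneq u i => //.
by rewrite others //; exact: IHp.
Qed.

Lemma count_enum (T : finType) (P : pred T) : count P (enum T) = #|P|.
Proof. by rewrite enumT cardE -size_filter. Qed.

Lemma run_Degree s a i : vget s v_n = n -> vget s v_i = i ->
  holds_graph a_matrix s a -> vget (run Degree s) v_size = #|a i|.+1.
Proof.
move=> sn si ma; rewrite /Degree run_CSeq; set s0 := run _ s.
rewrite -count_enum.
apply: (run_CFor_enum (I := fun p s =>
  vget s v_size = (count (a i) p).+1)) => //.
  exact: ltnW.
move=> p j s1 size_p fr1 IHp; set s2 := vset s1 v_j j.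
rewrite run_CWhen -cats1 count_cat /= addn0.
rewrite (frame_var fr1) // [vget s0 v_i]si !minn_ord_cap (frame_array fr1) //.
rewrite [aget s0 _ _ _]ma eqb0; case: (a i j) => /=; last by rewrite addn0.
rewrite IHp !addn1 (minn_idPl _) //.
by have := count_size (a i) p; have := ltn_ord j; rewrite -size_p; lia.
Qed.

Definition holds_profile s (N : nat -> nat) : Prop :=
  forall x, 0 < x <= cap -> aget s a_profile 0 x = N x.

Lemma run_clear_profile s :
  holds_profile
    (run (CFor v_size ECap (CPut1 a_profile (EAdd v_size 1) 0)) s) (fun=> 0).
Proof.
apply: (run_CFor (I := fun m s =>
  forall x, 0 < x <= m -> aget s a_profile 0 x = 0)) => //.
  by move=> x; lia.
move=> m s1 lt_m _ IHm x x_le; rewrite /= min0n addn1 !(minn_idPl lt_m) /=.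
by case: eqP => // ne; apply: IHm; lia.
Qed.

Lemma run_InitProfile s a : vget s v_n = n -> holds_graph a_matrix s a ->
  holds_profile (run InitProfile s) (degree_profile a).
Proof.
move=> sn ma; rewrite /InitProfile run_CSeq.
set s0 := run _ s; set loop := CFor _ _ _.
suff : forall x, 0 < x <= cap -> aget (run loop s0) a_profile 0 x =
    count (fun i => #|a i|.+1 == x) (enum 'I_n).
  move=> counted x x_le.
  by rewrite counted // count_enum /degree_profile cardsE.
apply: (run_CFor_enum (I := fun p s => forall x, 0 < x <= cap ->
  aget s a_profile 0 x = count (fun i => #|a i|.+1 == x) p)) => //.
- by rewrite /= run_var.
- exact: ltnW.
- by move=> x x_le; exact: run_clear_profile.
move=> p i s1 size_p fr1 IHp x x_le; rewrite run_CSeq; set s2 := run Degree _.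
have s2_profile : aget s2 a_profile = aget s1 a_profile by rewrite run_array.
have s2_size : vget s2 v_size = #|a i|.+1.
  apply: run_Degree => //=; first by rewrite (frame_var fr1) // run_var.
  by move=> u v; rewrite /= (frame_array fr1) // run_array.
have deg_cap : #|a i| < cap.
  by apply: leq_ltn_trans (max_card _) _; rewrite card_ord.
rewrite aget_CPut1 s2_size // -cats1 count_cat [eval _ _]/= /= addn0.
rewrite [x == _]eq_sym.
have [<-|ne] := eqVneq #|a i|.+1 x; last by rewrite addn0 s2_profile IHp.
rewrite min0n s2_size !(minn_idPl _) // s2_profile IHp // addn1 //.
have := count_size (fun j => #|a j|.+1 == #|a i|.+1) p; have := ltn_ord i.
by rewrite -size_p; lia.
Qed.

End GraphCommands.

Section Attempt.
Variables (W cap : nat) (inp : nat -> nat) (n k eta : nat).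
Hypothesis nk_cap : n + k + 2 <= cap.
Notation eval := (eval W cap inp).
Notation run := (run W cap inp).
Implicit Types (s : store) (a : rel 'I_n) (N : nat -> nat).

Let n_cap : n < cap. Proof. by lia. Qed.
Let k_cap : k < cap. Proof. by lia. Qed.

Definition holds_digits s (ds : seq nat) : Prop :=
  forall r, r < k -> aget s a_digits 0 r = nth 0 ds r.

Lemma repair_drop (ds : seq nat) a r : size ds <= r \/ find_P3 a = None ->
  repair (drop r ds) a = (a, drop r ds).
Proof.
case=> [/drop_oversize ->|]; first by rewrite /=; case: find_P3.
by case: drop => [|d ds'] /= ->.
Qed.

Lemma run_Repair s a ds : vget s v_n = n -> vget s v_k = k -> size ds = k ->
  holds_digits s ds -> simple_graph a -> holds_graph a_matrix s a ->
  let s' := run Repair s in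
  [/\ holds_graph a_matrix s' (repair ds a).1, vget s' v_used <= k
    & (repair ds a).2 = drop (vget s' v_used) ds].
Proof.
move=> sn sk ds_size sds sa ma s'; rewrite {}/s' /Repair run_CSeq.
set s0 := run _ s.
pose I r (s' : store) :=
  exists a1, [/\ simple_graph a1, holds_graph a_matrix s' a1,
  vget s' v_used <= r, repair (drop (vget s' v_used) ds) a1 = repair ds a
  & vget s' v_used = r \/ find_P3 a1 = None].
set loop := CFor _ _ _; suff : I k (run loop s0).
  case=> a1 [_ ma1 used_k <- fin]; rewrite repair_drop //.
  by case: fin => [->|]; [left; rewrite ds_size | right].
apply: run_CFor => //; first exact: ltnW.
  by exists a; split=> //; rewrite ?drop0 //; left.
move=> r s1 lt_rk fr [a1 [sa1 ma1 used_r rep fin]].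
rewrite run_CSeq; set s2 := run FindP3 _.
have s2P3 : holds_P3 s2 (find_P3 a1).
  by apply: run_FindP3 => //; rewrite /= (frame_var fr).
have ma2 : holds_graph a_matrix s2 a1.
  by move=> u v; rewrite run_array //; exact: ma1.
have used2 : vget s2 v_used = vget s1 v_used by rewrite run_var.
rewrite run_CWhen [eval _ _]/=; case e: (find_P3 a1) s2P3 fin => [t|].
  case: t e => [[x y] z] e s2P3 [used_eq|//].
  have [-> _ _ _] := s2P3; rewrite [1 == 0]/=.
  have [|| ma3 used3] :=
    @run_ToggleP3 W cap inp n n_cap s2 a1 (x, y, z) (nth 0 ds r)
    _ _ sa1 ma2 e s2P3; first by rewrite used2; lia.
    by rewrite used2 used_eq run_array //= (frame_array fr) // -sds.
  exists (toggle_P3 a1 (x, y, z) (nth 0 ds r)); rewrite used3 used2 used_eq.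
  split=> //; last by left.
    exact: simple_toggle_P3 sa1 (find_P3_some e).
  by rewrite -rep used_eq [in RHS](drop_nth 0) ?ds_size //= e.
move=> /= -> _; exists a1; rewrite used2; split=> //; first exact: leqW.
by right.
Qed.

Lemma run_Take s x N v (b : bool) : x != v_failed -> vget s x = v ->
  0 < v <= cap -> holds_profile cap s N -> vget s v_failed = b ->
  holds_profile cap (run (Take x) s) (upd N v (N v - v)) /\
  vget (run (Take x) s) v_failed = b || (N v < v).
Proof.
move=> ne sx v_le sN sb; rewrite /Take run_CSeq run_CIfLe.
rewrite eval_EGet1 sx; last by lia.
rewrite sN // [eval _ _]/= sx; set s1 := if _ then _ else _.
have s1x : vget s1 x = v.
  by rewrite /s1; case: ifP => //= _; rewrite (negbTE ne).
have s1N : holds_profile cap s1 N by rewrite /s1; case: ifP.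
split; last by rewrite run_var // /s1; case: leqP => /= _; rewrite ?orbT ?orbF.
move=> y y_le; rewrite aget_CPut1 s1x; last by lia.
rewrite /upd [eval _ _]/= s1x min0n (minn_idPl _); last by lia.
by rewrite !s1N.
Qed.

Lemma run_Give s x N v : vget s x = v -> 0 < v <= cap -> N v + v <= cap ->
  holds_profile cap s N ->
  holds_profile cap (run (Give x) s) (upd N v (N v + v)).
Proof.
move=> sx v_le Nv_le sN y y_le; rewrite aget_CPut1 sx; last by lia.
rewrite /upd [eval _ _]/= sx min0n (minn_idPl (_ : v <= cap)); last by lia.
by rewrite !sN // (minn_idPl _).
Qed.

Lemma run_Pay s p q c (b : bool) : vget s v_part1 = p -> vget s v_part2 = q ->
  vget s v_cost = c -> vget s v_failed = b -> vget s v_k = k ->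
  p <= cap -> q <= cap -> c <= cap ->
  vget (run Pay s) v_cost = minn (c + p * q) cap /\
  vget (run Pay s) v_failed = b || (k < c + p * q).
Proof.
move=> sp sq sc sb sk p_le q_le c_le; rewrite /Pay run_CSeq; set s1 := run _ s.
have s1c : vget s1 v_cost = minn (c + p * q) cap.
  apply: (run_CFor (I := fun i s =>
    vget s v_cost = minn (c + i * q) cap)) => //.
    by rewrite addn0 (minn_idPl c_le).
  move=> i s2 _ fr2 IHi.
  have -> : c + i.+1 * q = c + i * q + q by rewrite mulSn; lia.
  apply: (run_CFor (I := fun j s =>
    vget s v_cost = minn (c + i * q + j) cap)) => //.
  - by rewrite /= (frame_var fr2).
  - by rewrite /= IHi addn0.
  by move=> j s3 _ _ IHj; rewrite /= IHj; lia.
rewrite run_CIfLe [eval _ _]/= s1c [eval _ _]/= run_var // sk.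
rewrite (_ : (_ <= k) = (c + p * q <= k)); last by lia.
have s1b : vget s1 v_failed = b by rewrite run_var.
by case: leqP => /=; rewrite ?s1b ?orbF ?orbT.
Qed.

Definition holds_state s (o : option move_state) : Prop :=
  if o is Some (MoveState N p q c) then
    [/\ holds_profile cap s N, vget s v_part1 = p, vget s v_part2 = q,
        vget s v_cost = c & vget s v_failed = 0]
  else vget s v_failed = 1.

Lemma run_Settle s N p q c (b : bool) : (b -> holds_profile cap s N) ->
  vget s v_part1 = p -> vget s v_part2 = q -> vget s v_cost = c ->
  vget s v_failed = nat_of_bool (~~ b) -> vget s v_k = k ->
  p <= cap -> q <= cap -> c <= cap ->
  holds_state (run Settle s)
    (if b && (c + p * q <= k) then Some (MoveState N 1 1 (c + p * q))
     else None).
Proof.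
move=> sN sp sq sc sb sk p_le q_le c_le; rewrite /Settle run_CSeq.
have [] := run_Pay sp sq sc sb sk p_le q_le c_le.
set s1 := run Pay s => s1c s1b.
case: b sN sb s1b => /= sN sb s1b //; case: leqP s1b => /= c_pq s1b //.
split=> //; last by rewrite s1c; lia.
by move=> x x_le; rewrite /= /s1 run_array //; exact: (sN isT).
Qed.

Section OneStep.
Variables (s : store) (N : nat -> nat) (p q c : nat).
Hypothesis s_state : holds_state s (Some (MoveState N p q c)).
Hypothesis sk : vget s v_k = k.
Hypotheses (p0 : 0 < p) (q0 : 0 < q) (c_k : c <= k).
Hypothesis pq_k : p + q <= k + 2.
Hypothesis N_n : forall x, N x <= n.

Let p_le : 0 < p <= cap. Proof. by lia. Qed.
Let q_le : 0 < q <= cap. Proof. by lia. Qed.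
Let pq_le : 0 < p + q <= cap. Proof. by lia. Qed.

Lemma upd_le x y v : v <= N y -> upd N y v x <= n.
Proof. by rewrite /upd; case: eqP => // _ /leq_trans->. Qed.

Lemma upd_split : can_split N p q ->
  let N1 := upd N (p + q) (N (p + q) - (p + q)) in
  let N2 := upd N1 p (N1 p + p) in
  upd N2 q (N2 q + q) =1 split_profile N p q.
Proof.
have [p_ne q_ne] : (p == p + q) = false /\ (q == p + q) = false by lia.
move=> can N1 N2 x; rewrite /can_split in can.
rewrite {}/N2 {}/N1 /upd /split_profile p_ne q_ne.
have [->|xq] := eqVneq x q.
  by rewrite [p + q == q]eq_sym q_ne; have [->|_] := eqVneq q p; lia.
have [->|xp] := eqVneq x p; first by rewrite [p + q == p]eq_sym p_ne; lia.
by have [->|_] := eqVneq x (p + q); lia.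
Qed.

Lemma upd_merge : can_merge N p q ->
  let N1 := upd N p (N p - p) in
  let N2 := upd N1 q (N1 q - q) in
  upd N2 (p + q) (N2 (p + q) + (p + q)) =1 merge_profile N p q.
Proof.
have [p_ne q_ne] : (p + q == p) = false /\ (p + q == q) = false by lia.
move=> _ N1 N2 x; rewrite {}/N2 {}/N1 /upd /merge_profile p_ne q_ne.
have [->|xpq] := eqVneq x (p + q); first by lia.
have [->|xq] := eqVneq x q; last by have [->|_] := eqVneq x p; lia.
by have [->|_] := eqVneq q p; lia.
Qed.

Lemma run_Split : holds_state (run Split s) (step k (MoveState N p q c) 0).
Proof.
have [sN sp sq sc sf] := s_state; rewrite /Split run_CSeq; set s1 := run _ s.
have s1s : vget s1 v_size = p + q by rewrite /= sp sq (minn_idPl _) //; lia.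
have := @run_Take s1 v_size N (p + q) false isT s1s pq_le sN sf.
rewrite run_CSeq; set s2 := run _ s1; set N2 := upd N _ _ => -[s2N s2f].
have N2p : N2 p <= n by apply: upd_le; rewrite leq_subr.
have N2q : N2 q <= n by apply: upd_le; rewrite leq_subr.
have s2p : vget s2 v_part1 = p by rewrite run_var.
have := run_Give s2p p_le _ s2N; rewrite run_CSeq; set s3 := run _ s2.
set N3 := upd N2 _ _ => /(_ ltac:(lia)) s3N.
have N3q : N3 q + q <= cap by rewrite /N3 /upd; case: eqP => [qp|_]; lia.
have s3q : vget s3 v_part2 = q by rewrite !run_var.
have := run_Give s3q q_le N3q s3N; rewrite run_CSeq; set s4 := run _ s3 => s4N.
apply: run_Settle; try by [lia | rewrite !run_var].
  by move=> can x x_le; rewrite s4N // upd_split.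
by rewrite 2?run_var // s2f /can_split ltnNge.
Qed.

Lemma run_Merge : holds_state (run Merge s) (step k (MoveState N p q c) 1).
Proof.
have [sN sp sq sc sf] := s_state; rewrite /Merge run_CSeq; set s1 := run _ s.
have s1s : vget s1 v_size = p + q by rewrite /= sp sq (minn_idPl _) //; lia.
have := @run_Take s1 v_part1 N p false isT sp p_le sN sf.
rewrite run_CSeq; set s2 := run _ s1; set N2 := upd N _ _ => -[s2N s2f].
have s2q : vget s2 v_part2 = q by rewrite run_var.
have := run_Take (isT : v_part2 != v_failed) s2q q_le s2N s2f.
rewrite run_CSeq; set s3 := run _ s2; set N3 := upd N2 _ _ => -[s3N s3f].
have N2_n x : N2 x <= n by apply: upd_le; rewrite leq_subr.
have N3pq : N3 (p + q) + (p + q) <= cap.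
  have : N3 (p + q) <= n.
    rewrite /N3 /upd; case: eqP => _ //.
    exact: leq_trans (leq_subr _ _) (N2_n q).
  by lia.
have s3s : vget s3 v_size = p + q by rewrite 2?run_var.
have := run_Give s3s pq_le N3pq s3N.
rewrite run_CSeq; set s4 := run _ s3 => s4N.
apply: run_Settle; try by [lia | rewrite !run_var].
  by move=> can x x_le; rewrite s4N // upd_merge.
rewrite run_var // s3f /can_merge /= negb_and -!ltnNge /N2 /upd.
by case: (eqVneq q p) => [->|_]; rewrite ?mul1n ?subn0.
Qed.

End OneStep.

Lemma run_Step s st d : holds_state s (Some st) -> vget s v_k = k ->
  0 < part1 st -> 0 < part2 st -> cost st <= k ->
  part1 st + part2 st <= k + 2 ->
  (forall x, sizes st x <= n) -> vget s v_used + vget s v_round <= cap ->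
  aget s a_digits 0 (vget s v_used + vget s v_round) = d ->
  holds_state (run Step s) (step k st d).
Proof.
case: st => N p q c ss sk p0 q0 c_k pq_k N_n pos_cap sd.
rewrite /= in p0 q0 c_k pq_k N_n.
rewrite /Step run_CSeq; set s1 := run _ s.
have s1d : vget s1 v_digit = d by rewrite /= min0n !(minn_idPl pos_cap).
have s1s : holds_state s1 (Some (MoveState N p q c)) by exact: ss.
have s1k : vget s1 v_k = k by [].
clearbody s1; rewrite !run_CIfLe /= s1d; case: d {sd s1d} => [|[|[|d]]].
- exact: run_Split.
- exact: run_Merge.
- have [s1N s1p s1q s1c s1f] := s1s; split=> //=.
  by rewrite s1p addn1 (minn_idPl _) //; lia.
- have [s1N s1p s1q s1c s1f] := s1s; split=> //=.
  by rewrite s1q addn1 (minn_idPl _) //; lia.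
Qed.

Lemma run_Moves s a a' ds : vget s v_k = k -> vget s v_used <= k ->
  size ds = k -> holds_digits s ds ->
  holds_profile cap s (degree_profile a') ->
  attained k a (initial a' (vget s v_used)) ->
  holds_state (run Moves s)
    (steps k (drop (vget s v_used) ds) (Some (initial a' (vget s v_used)))).
Proof.
move=> sk; set u := vget s v_used => u_k ds_size sds sN att.
rewrite /Moves 4!run_CSeq; set s0 := run (v_failed ::= 0) _.
set rest := drop u ds.
have rest_size : size rest = k - u by rewrite size_drop ds_size.
rewrite -(take_size rest) rest_size.
apply: (run_CFor (I := fun r s =>
  holds_state s (steps k (take r rest) (Some (initial a' u))))).
- by rewrite /= sk.
- by lia.
- by rewrite take0.
move=> r s1 r_lt fr1 IHr; set s2 := vset s1 v_round r.
rewrite (take_nth 0) ?rest_size // -cats1 steps_cat run_CUnless [eval _ _]/=.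
case e: (steps k (take r rest) _) IHr => [st|] /= IHr; last by rewrite IHr.
have [p0 q0 c_k _] := steps_attained att e.
have s1f : vget s1 v_failed = 0 by case: st IHr {e p0 q0 c_k} => N p q c [].
have s2u : vget s2 v_used = u by rewrite /= (frame_var fr1).
rewrite s1f; apply: run_Step => //.
- by rewrite /= (frame_var fr1).
- have := part_sum_steps att e; rewrite size_take rest_size r_lt /=.
  by move: (part1 st + _) => x; lia.
- move=> x; rewrite -[n]card_ord.
  exact: attained_sizes_le (steps_attained att e).
- by rewrite s2u /=; lia.
- by rewrite s2u [vget s2 _]/= (frame_array fr1) // nth_drop sds //; lia.
Qed.

Lemma iota_rcons m r : iota m r.+1 = rcons (iota m r) (m + r).
Proof. by rewrite -addn1 iotaD cats1. Qed.

Lemma run_CheckBalance s N (b : bool) : vget s v_n = n -> vget s v_eta = eta ->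
  holds_profile cap s N -> vget s v_failed = b ->
  vget (run CheckBalance s) v_failed = b || ~~ balanced_profile 'I_n eta N.
Proof.
move=> sn seta sN sb; rewrite /balanced_profile card_ord.
set ok := fun x y : nat => _.
apply: (run_CFor (I := fun i s =>
  vget s v_failed = b || ~~ allrel ok (iota 1 i) (iota 1 n))) => //.
- exact: ltnW.
- by rewrite orbF.
move=> i s1 i_lt fr1 IHi; set s2 := vset s1 v_i i.
rewrite iota_rcons add1n -cats1 allrel_catl allrel1l negb_and orbA.
set b' := _ || _ in IHi *.
apply: (run_CFor (I := fun j s =>
  vget s v_failed = b' || ~~ all (ok i.+1) (iota 1 j))).
- by rewrite /= (frame_var fr1).
- exact: ltnW.
- by rewrite orbF.
move=> j s3 j_lt fr3 IHj; set s4 := vset s3 v_j j.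
have s4N x : 0 < x <= cap -> aget s4 a_profile 0 x = N x.
  by move=> x_le; rewrite /= (frame_array fr3) //= (frame_array fr1) // sN.
have s4i : vget s4 v_i = i by rewrite /= (frame_var fr3).
have s4eta : vget s4 v_eta = eta.
  by rewrite /= (frame_var fr3) //= (frame_var fr1).
have s4j : vget s4 v_j = j by [].
have s4f : vget s4 v_failed = b' || ~~ all (ok i.+1) (iota 1 j) by [].
have okE : ok i.+1 j.+1 = [|| N i.+1 == 0, N j.+1 == 0 | i - j <= eta].
  by rewrite /ok subSS.
clearbody s4; rewrite iota_rcons add1n all_rcons okE 2!run_CWhen run_CIfLe.
have getE x y : vget s4 x = y -> y < n ->
    eval s4 (EGet1 a_profile (EAdd x 1)) = N y.+1.
  move=> s4x y_lt; rewrite -s4N; last by lia.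
  by rewrite /EGet1 [eval _ _]/= s4x addn1 min0n !(minn_idPl _) //; lia.
rewrite (getE v_i i) // (getE v_j j) // [eval _ (ESub _ _)]/= s4i s4j.
rewrite [eval _ _]/= s4eta.
case: (N i.+1 == 0) => //; case: (N j.+1 == 0) => //.
by case: (i - j <= eta) => //=; rewrite orbT.
Qed.

Lemma run_Verdict s a o (x : bool) : vget s v_n = n -> vget s v_eta = eta ->
  holds_graph a_matrix s a -> (find_P3 a = None -> holds_state s o) ->
  vget s v_answer = x ->
  vget (run Verdict s) v_answer =
  x || (find_P3 a == None) &&
       (if o is Some st then balanced_profile 'I_n eta (sizes st) else false).
Proof.
move=> sn seta ma so sx; rewrite /Verdict run_CSeq; set s1 := run _ s.
have s1P3 : holds_P3 s1 (find_P3 a) by exact: run_FindP3.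
rewrite run_CSeq; set s2 := run CheckBalance s1.
have s2x : vget s2 v_answer = x by rewrite !run_var.
have found : vget s2 v_found = (find_P3 a != None).
  by rewrite run_var //; case: (find_P3 a) s1P3 => [[[u v] w] []|].
case: eqP found => [nP3|_] found; last first.
  by clearbody s2; rewrite run_CUnless /= found orbF.
have s1o : holds_state s1 o.
  case: o {so} (so nP3) => [[N p q c]|] /=; rewrite ?run_var // => -[sN].
  by split; rewrite ?run_var // => y y_le; rewrite run_array // sN.
have failed : vget s2 v_failed =
    ~~ (if o is Some st then balanced_profile 'I_n eta (sizes st) else false).
  case: o s1o {so} => [[N p q c] [s1N _ _ _ s1f]|s1f].
    by rewrite (@run_CheckBalance s1 N false) // run_var.
  by rewrite (@run_CheckBalance s1 (aget s1 a_profile 0) true) // run_var.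
clearbody s2; rewrite !run_CUnless /= found failed eqb0 negbK.
by case: (if o is Some st then _ else _); rewrite /= ?orbF ?orbT.
Qed.

Lemma run_TryDigits s a ds (x : bool) :
  vget s v_n = n -> vget s v_k = k -> vget s v_eta = eta ->
  vget s v_answer = x -> size ds = k -> holds_digits s ds ->
  simple_graph a -> holds_graph a_input s a ->
  vget (run TryDigits s) v_answer = x || accepts_digits k eta ds a.
Proof.
move=> sn sk seta sx ds_size sds sa ia; rewrite /TryDigits run_CSeq.
have := run_CopyInput W inp n_cap sn ia; set s1 := run _ s => ma1.
have sds1 : holds_digits s1 ds by move=> r r_lt; rewrite run_array // sds.
have s1n : vget s1 v_n = n by rewrite run_var.
have s1k : vget s1 v_k = k by rewrite run_var.
have [ma2 used_k rest_eq] := run_Repair s1n s1k ds_size sds1 sa ma1.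
rewrite run_CSeq; set s2 := run Repair s1 in ma2 used_k rest_eq *.
have s2n : vget s2 v_n = n by rewrite !run_var.
have := run_InitProfile W inp n_cap s2n ma2; rewrite run_CSeq.
set s3 := run _ s2 => s3N; rewrite run_CSeq; set s4 := run Moves s3.
have used3 : vget s3 v_used = vget s2 v_used by rewrite run_var.
rewrite /accepts_digits.
case rep: (repair ds a) ma2 rest_eq s3N => [a' rest] /= ma2 rest_eq s3N.
have rest_size : size ds - size rest = vget s2 v_used.
  by rewrite rest_eq size_drop ds_size subKn.
have s4_graph : holds_graph a_matrix s4 a'.
  by move=> i j; rewrite /s4 run_array // /s3 run_array.
have s4n : vget s4 v_n = n by rewrite /s4 run_var // /s3 run_var.
have s2eta : vget s2 v_eta = eta by rewrite /s2 run_var // /s1 run_var.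
have s4eta : vget s4 v_eta = eta by rewrite /s4 run_var // /s3 run_var.
have s2x : vget s2 v_answer = x by rewrite /s2 run_var // /s1 run_var.
have s4x : vget s4 v_answer = x by rewrite /s4 run_var // /s3 run_var.
apply: (run_Verdict s4n s4eta s4_graph) s4x => nP3.
have s3k : vget s3 v_k = k by rewrite /s3 run_var // /s2 run_var.
have sds3 : holds_digits s3 ds.
  by move=> r r_lt; rewrite /s3 run_array // /s2 run_array // sds1.
have := attained_initial sa (eq_leq ds_size) rep nP3.
rewrite rest_size rest_eq -used3 => att; apply: run_Moves att => //.
by rewrite used3.
Qed.

Lemma run_CarryDigit s v i : i < k -> vget s v_round = i ->
  (forall r, r < k ->
    aget s a_digits 0 r = digit 4 (if r < i then v.+1 else v) r) ->
  vget s v_carry = (4 ^ i %| v.+1) ->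
  let s' := run CarryDigit s in
  (forall r, r < k ->
    aget s' a_digits 0 r = digit 4 (if r < i.+1 then v.+1 else v) r) /\
  vget s' v_carry = (4 ^ i.+1 %| v.+1).
Proof.
move=> i_lt si sd sc s'; have i_cap : i <= cap by lia.
have sdi : aget s a_digits 0 i = digit 4 v i by rewrite sd // ltnn.
have sd' r : r < k -> r != i ->
    aget s a_digits 0 r = digit 4 (if r < i.+1 then v.+1 else v) r.
  by move=> r_lt ri; rewrite sd // [in RHS]ltnS [in RHS]leq_eqVlt (negbTE ri).
rewrite {}/s' /CarryDigit run_CWhen [eval _ _]/= sc eqb0.
case: ifPn => [ndvd|/negPn dvd].
  split=> [r r_lt|].
    have [->|ri] := eqVneq r i; last exact: sd'.
    by rewrite ltnSn digit_no_carry.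
  have ndvdS : (4 ^ i.+1 %| v.+1) = false.
    by apply: contraNF ndvd; apply: dvdn_trans; rewrite expnS dvdn_mull.
  by rewrite sc (negbTE ndvd) ndvdS.
have [dig_S ->] := digit_carry (isT : 0 < 4) dvd.
have dig_lt : digit 4 v i < 4 by rewrite ltn_mod.
rewrite run_CIfLe eval_EGet1 si // sdi [eval _ 3]/=; case: ifPn => dig3.
  have dig_eq : digit 4 v i = 3 by lia.
  split=> [r r_lt|]; last by rewrite /= sc dvd dig_eq.
  rewrite aget_CPut1 si //; have [->|ri] := eqVneq r i; last exact: sd'.
  by rewrite ltnSn dig_S dig_eq.
have dig_ne : (digit 4 v i == 4.-1) = false by lia.
split=> [r r_lt|]; last by rewrite dig_ne.
rewrite run_CSeq [run (v_carry ::= 0) _]/= /= si min0n (minn_idPl i_cap) sdi.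
have [->|ri] := eqVneq r i; last exact: sd'.
by rewrite ltnSn dig_S dig_ne addn1 (minn_idPl _) //; lia.
Qed.

Lemma run_NextDigits s v : v < 4 ^ k -> vget s v_k = k ->
  holds_digits s (digits 4 k v) ->
  holds_digits (run NextDigits s) (digits 4 k v.+1) /\
  vget (run NextDigits s) v_running =
    if v.+1 == 4 ^ k then 0 else vget s v_running.
Proof.
move=> v_lt sk sd; rewrite /NextDigits run_CSeq; set s0 := run _ s.
rewrite run_CSeq; set loop := CFor _ _ _.
have [s1d s1c] : (forall r, r < k -> aget (run loop s0) a_digits 0 r =
      digit 4 (if r < k then v.+1 else v) r) /\
    vget (run loop s0) v_carry = (4 ^ k %| v.+1).
  apply: (run_CFor (I := fun i s => (forall r, r < k -> aget s a_digits 0 r =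
    digit 4 (if r < i then v.+1 else v) r) /\
      vget s v_carry = (4 ^ i %| v.+1))) => //.
  - exact: ltnW.
  - by rewrite dvd1n; split=> // r r_lt; rewrite /= sd // nth_mkseq.
  by move=> i s1 i_lt _ [IHd IHc]; exact: run_CarryDigit.
have s1r : vget (run loop s0) v_running = vget s v_running by rewrite run_var.
set s1 := run loop s0 in s1d s1c s1r *; split.
  by move=> r r_lt; rewrite nth_mkseq // run_array // s1d // r_lt.
rewrite run_CWhen [eval _ _]/= s1c eqb0.
have -> : (v.+1 == 4 ^ k) = (4 ^ k %| v.+1).
  by apply/eqP/idP => [->//|/(dvdn_leq (ltn0Sn v))]; lia.
by case: (4 ^ k %| v.+1).
Qed.

(* The state of the machine when all digit strings before the [v]-th, read in
   base 4, have been tried. *)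
Definition loop_invariant s a v : Prop :=
  [/\ vget s v_n = n, vget s v_k = k & vget s v_eta = eta] /\
  [/\ holds_graph a_input s a, holds_digits s (digits 4 k v),
      vget s v_answer =
        has (fun u => accepts_digits k eta (digits 4 k u) a) (iota 0 v)
    & vget s v_running = (v != 4 ^ k)].

Lemma run_Body s a v : simple_graph a -> v < 4 ^ k ->
  loop_invariant s a v -> loop_invariant (run Body s) a v.+1.
Proof.
move=> sa v_lt [[sn sk seta] [ia sd sx sr]]; rewrite /Body run_CSeq.
set s1 := run TryDigits s.
have s1x := run_TryDigits sn sk seta sx (size_mkseq _ _) sd sa ia.
have s1k : vget s1 v_k = k by rewrite run_var.
have s1d : holds_digits s1 (digits 4 k v).
  by move=> r r_lt; rewrite run_array // sd.
have [s2d s2r] := run_NextDigits v_lt s1k s1d.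
set s2 := run NextDigits s1 in s2d s2r *.
have keep_var x : x \notin mod_vars NextDigits -> x \notin mod_vars TryDigits ->
    vget s2 x = vget s x by move=> xN xT; rewrite /s2 run_var // /s1 run_var.
split; first by split; rewrite keep_var.
split=> //.
- by move=> i j; rewrite /s2 run_array // /s1 run_array.
- by rewrite /s2 run_var // s1x -[v.+1]addn1 iotaD has_cat /= orbF add0n.
rewrite s2r [vget s1 _]run_var // sr neq_ltn v_lt.
by case: (_ == _).
Qed.

End Attempt.

(** * Loading the input *)

Fixpoint StoreBits (c : nat) (bits : seq nat) : com :=
  if bits is b :: bits' then CPut1 a_bits c b;; StoreBits c.+1 bits' else CSkip.

Definition LoadCell (W : nat) : com :=
  CIfLe W v_cell (CPut a_input v_i v_j (EInput v_cell))
                 (CPut a_input v_i v_j (EGet1 a_bits v_cell));;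
  CIncr v_cell.

Definition LoadRow (W : nat) : com := CFor v_j v_n (LoadCell W).

Definition LoadMatrix (W : nat) : com :=
  v_cell ::= 3;; CFor v_i v_n (LoadRow W).

Definition ClearDigits : com := CFor v_round v_k (CPut1 a_digits v_round 0).

Definition Setup (W : nat) (bits : seq nat) : com :=
  StoreBits 3 bits;; LoadMatrix W;; ClearDigits;; v_answer ::= 0;;
    v_running ::= 1.

Lemma mod_vars_StoreBits c bits : mod_vars (StoreBits c bits) = [::].
Proof. by elim: bits c => //= b bits IH c; rewrite IH. Qed.

Lemma com_time_StoreBits NA cap c bits bits' : size bits = size bits' ->
  com_time NA cap (StoreBits c bits) = com_time NA cap (StoreBits c bits').
Proof. by elim: bits bits' c => [|b bits IH] [|b' bits'] c //= [] /IH ->. Qed.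

Lemma com_time_Setup NA cap W bits bits' : size bits = size bits' ->
  com_time NA cap (Setup W bits) = com_time NA cap (Setup W bits').
Proof. by move=> sz; congr (_ + _); exact: com_time_StoreBits. Qed.

Section Loading.
Variables (W cap : nat) (inp : nat -> nat) (n k eta : nat).
Hypothesis input_cap : W + 3 + n * n + k <= cap.
Hypothesis W3 : 3 <= W.
Notation eval := (eval W cap inp).
Notation run := (run W cap inp).
Implicit Types (i j : 'I_n) (cell : nat -> nat).

Let n_cap : n <= cap. Proof. by nia. Qed.

Let minn_ord_cap i : minn i cap = i. Proof. exact: minn_ord. Qed.

Lemma run_StoreBits bits c s y : c + size bits <= cap -> y <= cap ->
  aget (run (StoreBits c bits) s) a_bits 0 y =
  if c <= y < c + size bits then nth 0 bits (y - c) else aget s a_bits 0 y.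
Proof.
elim: bits c s => [|b bits IH] c s /= c_cap y_cap.
  by rewrite addn0 ltnNge andbN.
rewrite IH; [|lia|lia]; rewrite /= min0n (minn_idPl _); last by lia.
case: (ltngtP c y) => c_y.
- rewrite (_ : y < _ = (y < c + (size bits).+1)); last by lia.
  by rewrite (_ : y - c = (y - c.+1).+1); last by lia.
- by [].
- by rewrite c_y subnn /= (_ : y < _) //; lia.
Qed.

Definition holds_input s cell : Prop :=
  (forall y, 3 <= y < W -> aget s a_bits 0 y = cell y) /\
  (forall y, W <= y < cap -> inp y = cell y).

Lemma run_LoadCell s cell i j c : holds_input s cell ->
  vget s v_i = i -> vget s v_j = j -> vget s v_cell = c -> 3 <= c < cap ->
  (forall u v : 'I_n, aget (run (LoadCell W) s) a_input u v =
     if (u == i) && (v == j) then cell c else aget s a_input u v) /\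
  vget (run (LoadCell W) s) v_cell = c.+1.
Proof.
move=> [s_bits inp_cell] si sj sc c_range; rewrite /LoadCell run_CSeq run_CIfLe.
rewrite [eval _ W]/= [eval _ v_cell]/= sc; set s1 := if _ then _ else _.
have s1c : vget s1 v_cell = c by rewrite /s1; case: ifP.
split=> [u v|]; last by rewrite vget_CIncr s1c //; lia.
rewrite run_array // /s1.
case: leqP => c_W; rewrite /= si sj sc !minn_ord_cap !val_eqE.
  by rewrite c_W /= (_ : c < cap) ?inp_cell //; lia.
by rewrite min0n (minn_idPl _) ?s_bits //; lia.
Qed.

Lemma run_LoadRow s cell i : holds_input s cell ->
  vget s v_n = n -> vget s v_i = i -> vget s v_cell = 3 + i * n ->
  [/\ forall j, aget (run (LoadRow W) s) a_input i j = cell (3 + (i * n + j)),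
      forall u j, u != i ->
        aget (run (LoadRow W) s) a_input u j = aget s a_input u j
    & vget (run (LoadRow W) s) v_cell = 3 + (i * n + n)].
Proof.
move=> [s_bits inp_cell] sn si sc.
have row_le : i * n + n <= n * n by rewrite -mulSnr leq_mul2r ltn_ord orbT.
have : [/\ forall j, j \in enum 'I_n ->
      aget (run (LoadRow W) s) a_input i j = cell (3 + (i * n + j)),
    forall u j, u != i ->
      aget (run (LoadRow W) s) a_input u j = aget s a_input u j
  & vget (run (LoadRow W) s) v_cell = 3 + (i * n + size (enum 'I_n))].
  apply: (run_CFor_enum (I := fun q s' => [/\ forall j, j \in q ->
      aget s' a_input i j = cell (3 + (i * n + j)),
    forall u j, u != i -> aget s' a_input u j = aget s a_input u j
    & vget s' v_cell = 3 + (i * n + size q)])) => //.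
    by split=> //; rewrite addn0.
  move=> q j s1 size_q fr [row_q others s1c]; rewrite size_q in s1c.
  have s1_input : holds_input (vset s1 v_j j) cell.
    by split=> // y y_range; rewrite /= (frame_array fr) // s_bits.
  have s1i : vget (vset s1 v_j j) v_i = i by rewrite /= (frame_var fr).
  have [|stored s2c] :=
    run_LoadCell s1_input s1i (erefl : vget (vset s1 v_j j) v_j = j) s1c.
    by have := ltn_ord j; lia.
  split=> [v|u v ui|]; last by rewrite s2c size_rcons size_q; lia.
    rewrite stored eqxx mem_rcons inE.
    by case: (eqVneq v j) => [->|_] //=; exact: row_q.
  by rewrite stored (negbTE ui) /=; exact: others.
rewrite size_enum_ord => -[loaded others s'c]; split=> // j.
by apply: loaded; rewrite mem_enum.
Qed.

Lemma run_LoadMatrix s cell i j : vget s v_n = n -> holds_input s cell ->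
  aget (run (LoadMatrix W) s) a_input i j = cell (3 + (i * n + j)).
Proof.
move=> sn [s_bits inp_cell]; rewrite /LoadMatrix run_CSeq; set s0 := run _ s.
set loop := CFor _ _ _.
have [loaded _] : (forall i j, i \in enum 'I_n ->
      aget (run loop s0) a_input i j = cell (3 + (i * n + j))) /\
    vget (run loop s0) v_cell = 3 + size (enum 'I_n) * n.
  apply: (run_CFor_enum (I := fun p s => (forall i j, i \in p ->
    aget s a_input i j = cell (3 + (i * n + j))) /\
    vget s v_cell = 3 + size p * n)) => //.
  move=> p i' s1 size_p fr [IHp s1c].
  have s1_input : holds_input (vset s1 v_i i') cell.
    by split=> // y y_range; rewrite /= (frame_array fr) //; exact: s_bits.
  have [||| row_i others s2c] := run_LoadRow (i := i') s1_input.
  - by rewrite /= (frame_var fr).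
  - by [].
  - by rewrite -size_p.
  split=> [u v|]; last by rewrite s2c size_rcons size_p; lia.
  rewrite mem_rcons inE; have [-> _|ui] /= := eqVneq u i'; first exact: row_i.
  by rewrite others //; exact: IHp.
by apply: loaded; rewrite mem_enum.
Qed.

Lemma run_ClearDigits s : vget s v_k = k ->
  holds_digits k (run ClearDigits s) (digits 4 k 0).
Proof.
move=> sk; have k_cap : k <= cap by nia.
suff cleared : forall r, r < k -> aget (run ClearDigits s) a_digits 0 r = 0.
  by move=> r r_lt; rewrite cleared // nth_mkseq // /digit div0n mod0n.
apply: (run_CFor (I := fun m s => forall r, r < m ->
  aget s a_digits 0 r = 0)) => //.
move=> m s1 m_lt _ IHm r r_lt; rewrite aget_CPut1 /=; last by lia.
by case: eqVneq => // ne; apply: IHm; lia.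
Qed.

Lemma run_Setup s bits cell (a : rel 'I_n) :
  vget s v_n = n -> vget s v_k = k -> vget s v_eta = eta ->
  bits = [seq cell y | y <- iota 3 (W - 3)] ->
  (forall y, W <= y < cap -> inp y = cell y) ->
  (forall i j, cell (3 + (i * n + j)) = a i j) ->
  loop_invariant k eta (run (Setup W bits) s) a 0.
Proof.
move=> sn sk seta bits_cell inp_cell cell_a; rewrite /Setup run_CSeq.
set s1 := run (StoreBits 3 bits) s.
have keep1 x : vget s1 x = vget s x by rewrite run_var // mod_vars_StoreBits.
have s1_input : holds_input s1 cell.
  have size_bits : size bits = W - 3 by rewrite bits_cell size_map size_iota.
  split=> // y y_range; rewrite run_StoreBits; try by lia.
  rewrite size_bits (_ : _ && _); last by lia.
  rewrite bits_cell (nth_map 0) ?size_iota; last by lia.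
  by rewrite nth_iota; [congr cell|]; lia.
have s1n : vget s1 v_n = n by rewrite keep1.
have loaded i j := run_LoadMatrix i j s1n s1_input.
rewrite run_CSeq; set s2 := run (LoadMatrix W) s1 in loaded *.
have keep2 x : x \notin mod_vars (LoadMatrix W) -> vget s2 x = vget s x.
  by move=> xL; rewrite /s2 run_var // keep1.
have s2k : vget s2 v_k = k by rewrite keep2.
have cleared := run_ClearDigits s2k.
rewrite run_CSeq; set s3 := run ClearDigits s2 in cleared *.
have keep3 x : x \notin mod_vars ClearDigits ->
    x \notin mod_vars (LoadMatrix W) -> vget s3 x = vget s x.
  by move=> xC xL; rewrite /s3 run_var // keep2.
split; first by split; rewrite /= keep3.
split=> //; last by rewrite /= eq_sym expn_eq0.
by move=> i j; rewrite /= /s3 run_array // loaded.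
Qed.

End Loading.

(** * The whole program *)

(* All cells after the first three hold the adjacency matrix, so the machine has
   no fixed cell to work with: the bits in the first cells are remembered in the
   control state while these cells are reused. *)
Fixpoint ReadBits (b a : nat) (bits : seq nat) (K : seq nat -> prog) : prog :=
  if b is b'.+1 then
    If a (ReadBits b' a.+1 (rcons bits 1) K) (ReadBits b' a.+1 (rcons bits 0) K)
  else K bits.

Lemma runs_ReadBits b a bits K m T Q :
  (forall y, a <= y < a + b -> m y <= 1) ->
  runs (K (bits ++ [seq m y | y <- iota a b])) m T Q ->
  runs (ReadBits b a bits K) m (T + b) Q.
Proof.
elim: b a bits => [|b IH] a bits m_le1 /=; first by rewrite cats0 addn0.
rewrite -cat_rcons addnS => KQ.
have m_le1' y : a.+1 <= y < a.+1 + b -> m y <= 1.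
  by move=> y_le; apply: m_le1; lia.
have ma : m a <= 1 by apply: m_le1; lia.
apply: runs_If => ma0; apply: IH => //; last by rewrite -ma0.
by have <- : m a = 1 by lia.
Qed.

Definition num_vars := 24.
Definition num_arrays := 5.
Definition workspace := 64.

Definition bound n k := workspace + 3 + k + n * n.+1.

Definition ComputeBound : prog :=
  Seq (Const num_vars (workspace + 3))
  (Seq (Copy num_vars.+1 1) (Seq (AddMul num_vars.+1 num_vars.+2 num_vars 1)
  (Seq (Copy num_vars.+1 0)
    (AddProduct num_vars.+1 0 num_vars.+2 num_vars.+3 num_vars 1)))).

Lemma runs_ComputeBound m n k : m 0 = n -> m 1 = k ->
  runs ComputeBound m (5 + k * 5 + n * (n * 5 + 10))
    (fun m' => m' num_vars = bound n k /\
       changes (fun y => num_vars <= y <= num_vars.+3) m m').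
Proof.
move=> m0 m1.
apply: (@runs_le _ _ (1 + (1 + ((k * (1 + 4)).+1 +
  (1 + (n * (n.+1 * (1 + 4) + 5)).+1))))); first by lia.
apply: runs_Seq_exec (exec_Const _ _ _) _.
apply: runs_Seq_exec (exec_Copy _ _ _) _.
rewrite updNE // m1; set m2 := upd _ _ _.
have m2c : m2 num_vars.+1 = k by rewrite /m2 updE.
apply: runs_Seq; first by rewrite -m2c; exact: runs_AddMul.
move=> m3 [m3v m23]; apply: runs_Seq_exec (exec_Copy _ _ _) _.
have m30 : m3 0 = n by rewrite m23 // /m2 !updNE.
rewrite m30; set m4 := upd _ _ _.
have m4c : m4 num_vars.+1 = n by rewrite /m4 updE.
have m40 : m4 0 = n by rewrite /m4 updNE.
apply: runs_mono; last exact: (@runs_AddProduct num_vars.+1 0 num_vars.+2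
  num_vars.+3 num_vars 1 m4); first by rewrite m4c m40.
move=> m5 [m5v m45]; split.
  by rewrite m5v m4c m40 /m4 updNE // m3v m2c /m2 updNE // updE /bound; lia.
move=> y y_out; rewrite m45 ?inE; last by lia.
rewrite /m4 updNE; last by lia.
rewrite m23 ?inE; last by lia.
by rewrite /m2 !updNE //; lia.
Qed.

Definition machine_code : com -> prog :=
  compile num_vars num_arrays workspace num_vars.+1.

Definition machine_wf : com -> bool :=
  wf_com num_vars num_arrays workspace num_vars.+1.

Definition machine_state n k : (nat -> nat) -> store -> memory -> Prop :=
  represents num_vars num_arrays workspace (bound n k).

Definition machine_time n k : com -> nat := com_time num_arrays (bound n k).

Lemma workspace_bound n k : workspace <= bound n k.
Proof. by rewrite /bound; lia. Qed.

Lemma runs_machine_code n k inp c s m :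
  machine_wf c -> machine_state n k inp s m ->
  runs (machine_code c) m (machine_time n k c)
    (machine_state n k inp (run workspace (bound n k) inp c s)).
Proof.
move=> wf_c sm; apply: runs_mono
  (compile_correct _ (workspace_bound n k) (ltnSn num_vars) wf_c sm) => //.
by move=> m' [].
Qed.

Definition Main (bits : seq nat) : prog :=
  Seq ComputeBound (Seq (machine_code (Setup workspace bits))
    (Seq (While (var_id v_running) (machine_code Body))
         (Copy 0 (var_id v_answer)))).

Definition Algorithm : prog := ReadBits (workspace - 3) 3 [::] Main.

Lemma wf_Body : machine_wf Body.
Proof. by []. Qed.

Lemma wf_Setup bits : machine_wf (Setup workspace bits).
Proof.
suff wf_StoreBits c : machine_wf (StoreBits c bits).
  by rewrite /machine_wf /= [wf_com _ _ _ _ _]wf_StoreBits.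
by rewrite /machine_wf; elim: bits c => //= b bits IH c; rewrite IH.
Qed.

Lemma encode_adj n (E : {set {set 'I_n}}) k eta (i j : 'I_n) :
  encode E k eta (3 + (i * n + j)) = adj E i j.
Proof.
rewrite /encode /=; congr nat_of_bool.
apply/existsP/idP => [[x /existsP[y /andP[/eqP]]]|ij]; last first.
  by exists i; apply/existsP; exists j; rewrite eqxx.
by rewrite !add3n => -[] /mulnD_inj[] // /val_inj -> /val_inj ->.
Qed.

Lemma encode_le1 n (E : {set {set 'I_n}}) k eta y : 3 <= y ->
  encode E k eta y <= 1.
Proof. by case: y => [|[|[|y]]] // _; rewrite /encode /=; case: existsP. Qed.

Definition main_time n k bits : nat :=
  5 + k * 5 + n * (n * 5 + 10) + (machine_time n k (Setup workspace bits) +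
    ((4 ^ k * (machine_time n k Body).+1).+1 + 1)).

Lemma exists_digits_iff k (P : seq nat -> bool) :
  has (fun v => P (digits 4 k v)) (iota 0 (4 ^ k)) <->
  exists ds, [/\ size ds = k, all (fun d => d < 4) ds & P ds].
Proof.
split=> [/hasP[v _ Pv]|[ds [ds_size ds4 Pds]]].
  by exists (digits 4 k v); rewrite size_mkseq digits_lt.
have [v v_lt v_ds] := digits_surj (isT : 0 < 4) ds_size ds4.
by apply/hasP; exists v; rewrite ?v_ds // mem_iota.
Qed.

Lemma runs_Main n (E : {set {set 'I_n}}) k eta bits : E \subset pairs 'I_n ->
  bits = [seq encode E k eta y | y <- iota 3 (workspace - 3)] ->
  runs (Main bits) (encode E k eta) (main_time n k bits)
    (fun m => accepts m <-> balanced_cluster_editing E k eta).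
Proof.
move=> sE bits_eq; set m0 := encode E k eta in bits_eq *; set cap := bound n k.
have cap_setup : workspace + 3 + n * n + k <= cap by rewrite /cap /bound; nia.
have cap_body : n + k + 2 <= cap by rewrite /cap /bound /workspace; nia.
have sa := simple_adj sE.
apply: runs_Seq (@runs_ComputeBound m0 n k erefl erefl) _ => m1 [m1_cap m01].
pose s1 := Store (fun x => m1 (var_id x))
  (fun b i j => m1 (address num_arrays cap (array_id b) i j)).
have r1 : machine_state n k m0 s1 m1.
  split=> // y y_range; rewrite m01 //.
  by rewrite /num_vars /workspace in y_range *; lia.
have m1_in y : y < num_vars -> m1 y = m0 y.
  by move=> y_lt; rewrite m01 // negb_and -ltnNge y_lt.
have inv0 := run_Setup cap_setup (isT : 3 <= workspace)
  (m1_in 0 isT : vget s1 v_n = n) (m1_in 1 isT : vget s1 v_k = k)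
  (m1_in 2 isT : vget s1 v_eta = eta) bits_eq (fun y _ => erefl)
  (encode_adj E k eta).
apply: runs_Seq (runs_machine_code (wf_Setup bits) r1) _ => m2 r2.
pose I v (m : memory) := exists2 s,
  machine_state n k m0 s m & loop_invariant k eta s (adj E) v.
apply: runs_Seq.
  apply: (@runs_While _ _ (machine_time n k Body) (4 ^ k) I).
  - by exists (run workspace cap m0 (Setup workspace bits) s1).
  - move=> v m v_lt [s rs inv]; have [_ [_ _ _ s_running]] := inv.
    split; first by rewrite (rep_var rs) // s_running eqb0 negbK neq_ltn v_lt.
    apply: runs_mono (runs_machine_code wf_Body rs) => // m' rs'.
    by exists (run workspace cap m0 Body s) => //; exact: run_Body.
  - move=> m [s rs [_ [_ _ _ s_running]]].
    by rewrite (rep_var rs) // s_running eqxx.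
move=> m3 [s3 r3 [_ [_ _ s3_answer _]]]; apply: runs_exec (exec_Copy _ _ _) _.
rewrite /accepts updE (rep_var r3) // s3_answer eqb0 negbK.
rewrite (exists_digits_iff k (fun ds => accepts_digits k eta ds (adj E))).
by rewrite accepts_digits_iff // -balanced_cluster_editingP.
Qed.

Lemma main_time_bound : exists2 F, poly_bounded F &
  forall n (E : {set {set 'I_n}}) k eta,
    main_time n k [seq encode E k eta y | y <- iota 3 (workspace - 3)] +
      (workspace - 3) <= 4 ^ k * F (bound n k).
Proof.
pose setup_time cap :=
  com_time num_arrays cap (Setup workspace (nseq (workspace - 3) 0)).
pose body_time cap := com_time num_arrays cap Body.
exists (fun cap => 100 + 20 * cap + setup_time cap + body_time cap).
  have setup_poly : poly_bounded setup_time by exact: poly_bounded_com_time.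
  have body_poly : poly_bounded body_time by exact: poly_bounded_com_time.
  by poly.
move=> n E k eta; rewrite /main_time; set bits := map _ _.
have -> : machine_time n k (Setup workspace bits) = setup_time (bound n k).
  by apply: com_time_Setup; rewrite size_map size_iota size_nseq.
rewrite -[machine_time n k Body]/(body_time (bound n k)); set cap := bound n k.
have p_gt0 : 0 < 4 ^ k by rewrite expn_gt0.
have cap_time : 5 + k * 5 + n * (n * 5 + 10) + 63 <= 99 + 20 * cap.
  by rewrite /cap /bound /workspace; nia.
move: cap_time; rewrite /workspace; move: (4 ^ k) p_gt0 => P P_gt0.
move: (body_time cap) (setup_time cap) (20 * cap) (5 + _ + _) => B S C A A_le.
have : 99 + C + S <= P * (99 + C + S) by rewrite leq_pmull.
by rewrite !mulnDr mulnS; lia.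
Qed.

Lemma algorithm_correct : exists2 F, poly_bounded F &
  forall n (E : {set {set 'I_n}}) k eta, E \subset pairs 'I_n ->
  exists t m, [/\ exec Algorithm (encode E k eta) t m,
    accepts m <-> balanced_cluster_editing E k eta &
      t <= 4 ^ k * F (bound n k)].
Proof.
have [F F_poly F_time] := main_time_bound; exists F => // n E k eta sE.
have [|t [m [ex t_le Q]]] := @runs_ReadBits (workspace - 3) 3 [::] Main
    (encode E k eta) _ _ _ (runs_Main sE erefl).
  by move=> y /andP[y_ge _]; exact: encode_le1.
by exists t, m; split=> //; exact: leq_trans t_le (F_time _ _ _ _).
Qed.

Lemma bound_lt n k : bound n k < 70 * k.+1 * maxn n 1 ^ 2.
Proof.
rewrite /bound /workspace; set N := maxn n 1.
have n_le : n * n <= N ^ 2 by apply: leq_mul; exact: leq_maxl.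
have N_gt0 : 0 < N ^ 2 by rewrite expn_gt0 leq_maxr.
have n_sq : n <= n * n by case: (n) => // n'; rewrite leq_pmulr.
have k_le : k.+1 <= k.+1 * N ^ 2 by rewrite leq_pmulr.
have N_le : N ^ 2 <= k.+1 * N ^ 2 by rewrite leq_pmull.
by rewrite -mulnA mulnS; lia.
Qed.

Lemma algorithm_time : exists A C, forall n (E : {set {set 'I_n}}) k eta,
  E \subset pairs 'I_n ->
  exists t m, [/\ exec Algorithm (encode E k eta) t m,
    accepts m <-> balanced_cluster_editing E k eta &
    t <= 4 ^ k * (A.+1 * k.+1 ^ C) * maxn n 1 ^ (2 * C)].
Proof.
have [F [C F_le] correct] := algorithm_correct; exists (C * 70 ^ C), C.
move=> n E k eta sE; have [t [m [ex Q t_le]]] := correct n E k eta sE.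
exists t, m; split=> //; apply: leq_trans t_le _; rewrite -mulnA leq_mul2l.
apply/orP; right; apply: leq_trans (F_le _) _; rewrite expnM -!mulnA -expnMn.
apply: (@leq_trans (C * (70 * k.+1 * maxn n 1 ^ 2) ^ C)).
  rewrite leq_mul2l; have [//|C_gt0] := posnP C.
  by rewrite leq_exp2r // bound_lt.
by rewrite -[70 * _ * _]mulnA expnMn mulnA leq_mul2r leqnSn orbT.
Qed.

(** * The exponent of the running time *)

Import Order.TTheory GRing.Theory Num.Theory.
Import numFieldNormedType.Exports.
Local Open Scope classical_set_scope.
Local Open Scope ring_scope.

Lemma littleo_cst (R : realType) (a : R) :
  (fun=> a) =o_\oo (fun k : nat => k%:R : R).
Proof.
apply/eqoP => e e0; near=> k; rewrite normr_nat -ler_pdivrMl //.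
by near: k; exact: nbhs_infty_ger.
Unshelve. all: by end_near. Qed.

Lemma ln_le_linear (R : realType) (d x : R) : 0 < d -> 0 < x ->
  ln x <= d * x - ln d.
Proof.
move=> d0 x0; rewrite lerBrDr addrC -lnM ?posrE //.
by apply/ltW/ln_sublinear; rewrite mulr_gt0.
Qed.

Lemma littleo_ln (R : realType) :
  (fun k : nat => ln k.+1%:R : R) =o_\oo (fun k : nat => k%:R : R).
Proof.
apply/eqoP => e e0; have e20 : 0 < e / 2 by lra.
near=> k; rewrite normr_nat ger0_norm; last by rewrite ln_ge0 // ler1n.
apply: le_trans (ln_le_linear e20 _) _ => //.
have : (e / 2 - ln (e / 2)) / (e / 2) <= k%:R by near: k; exact: nbhs_infty_ger.
rewrite ler_pdivrMr // -(natr1 k); lra.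
Unshelve. all: by end_near. Qed.

Lemma littleo_affine_ln (R : realType) (a b : R) :
  (fun k : nat => a + b * ln k.+1%:R) =o_\oo (fun k : nat => k%:R : R).
Proof.
rewrite (_ : (fun k => _) = (fun=> a) + b *: (fun k => ln k.+1%:R)) //.
by apply: eqoE; rewrite (littleo_cst a) (littleo_ln R) scaleo addo.
Qed.

Lemma powR_log (R : realType) (a x : R) : 1 < a -> 0 < x ->
  a `^ (ln x / ln a) = x.
Proof.
move=> a1 x0; have la0 : ln a != 0 by rewrite gt_eqF // ln_gt0.
by rewrite /powR gt_eqF ?divfK ?lnK ?posrE //; lra.
Qed.

Lemma littleo_log_monomial (R : realType) (A C : nat) (b : R) :
  (fun k : nat => ln (A.+1 * k.+1 ^ C)%:R / ln b) =o_\oo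
  (fun k : nat => k%:R : R).
Proof.
rewrite (_ : (fun k => _) = fun k : nat =>
  ln A.+1%:R / ln b + C%:R / ln b * ln k.+1%:R); first exact: littleo_affine_ln.
apply/funext => k; rewrite natrM natrX lnM ?posrE ?exprn_gt0 ?ltr0n //.
by rewrite lnXn ?ltr0n // -[ln _ *+ C]mulr_natl mulrDl [in RHS]mulrAC.
Qed.

(* [maxn n 1] is [n] except for the graph without vertices, where [n ^+ c] would
   allow no step at all.  Constant factors are absorbed by [g]. *)
Theorem mainTheorem11 (R : realType) :
  exists (P : prog) (g : nat -> R) (c : nat),
    g =o_\oo (fun k : nat => k%:R : R) /\
    forall (n : nat) (E : {set {set 'I_n}}) (k eta : nat),
      E \subset pairs 'I_n ->
      exists (t : nat) (m : memory),
        [/\ exec P (encode E k eta) t m,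
            accepts m <-> balanced_cluster_editing E k eta
          & t%:R <= 4 `^ (k%:R + g k) * (maxn n 1)%:R ^+ c].
Proof.
have [A [C algorithm]] := algorithm_time.
exists Algorithm, (fun k => ln (A.+1 * k.+1 ^ C)%:R / ln 4), (2 * C)%N.
split=> [|n E k eta sE]; first exact: littleo_log_monomial.
have [t [m [ex correct t_le]]] := algorithm n E k eta sE.
exists t, m; split=> //; rewrite powRD; last by rewrite pnatr_eq0 implybT.
rewrite powR_mulrn // powR_log ?ltr0n ?muln_gt0 ?expn_gt0 ?ltr1n //.
by rewrite -!natrX -!natrM ler_nat.
Qed.
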